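(* Let $X\sim \mathrm{GH}(\lambda,\alpha,\beta,\delta,0)$, where $\lambda\in\mathbb{R}$, $\alpha>\beta>0$, $\delta>0$, and let $\gamma=\sqrt{\alpha^2-\beta^2}$. For $c\in\mathbb{R}$, set $$u_c=\frac{\beta}{\gamma^2}\left[\lambda-c+\sqrt{(\lambda-c)^2+\delta^2\gamma^2}\right].$$ Then $$\operatorname{Med}(X)<u_{-1/2}=\frac{\beta}{\gamma^2}\left[\lambda+\frac12+\sqrt{\left(\lambda+\frac12\right)^2+\delta^2\gamma^2}\right].$$ Moreover, $u_0=\frac{\beta}{\gamma^2}\left[\lambda+\sqrt{\lambda^2+\delta^2\gamma^2}\right]$, and $$\begin{cases}\operatorname{Med}(X)<u_0, & \lambda>0,\\ \operatorname{Med}(X)=u_0, & \lambda=0,\\ \operatorname{Med}(X)>u_0, & \lambda<0.\end{cases}$$ Furthermore, $c=-1/2$ is the largest real constant $c$ for which the upper bound $\operatorname{Med}(X)<u_c$ is valid uniformly over all $\lambda\in\mathbb{R}$ and $\delta>0$ (and all $\alpha>\beta>0$). On the range $\lambda\ge 1$, the largest real constant $c$ for which $\operatorname{Med}(X)<u_c$ is valid uniformly over all $\delta>0$ (and all $\lambda\ge1$, $\alpha>\beta>0$) is $c=0$.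
   Context: For $\lambda\in\mathbb{R}$, $\alpha>\beta>0$, $\delta>0$ and $\gamma=\sqrt{\alpha^2-\beta^2}$, the generalized hyperbolic distribution $\mathrm{GH}(\lambda,\alpha,\beta,\delta,0)$ is the distribution on $\mathbb{R}$ with density $$p(x)=\frac{(\gamma/\delta)^\lambda}{\sqrt{2\pi}K_\lambda(\delta\gamma)}e^{\beta x}\frac{K_{\lambda-1/2}\left(\alpha\sqrt{\delta^2+x^2}\right)}{\left(\sqrt{\delta^2+x^2}/\alpha\right)^{1/2-\lambda}},\qquad x\in\mathbb{R},$$ where $K_\nu$ is the modified Bessel function of the second kind. The median of a real-valued random variable $X$ is $\operatorname{Med}(X)=\inf\{x\in\mathbb{R}: P(X\le x)\ge 1/2\}$. The quantity $u_c$ depends on $(\lambda,\alpha,\beta,\delta)$ as well as on $c$. *)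

(* Defs.v *)
From HB Require Import structures.
From mathcomp Require Import all_boot all_order all_algebra.
From mathcomp Require Import all_classical all_reals all_analysis.
Set Implicit Arguments.
Unset Strict Implicit.
Unset Printing Implicit Defensive.
Import Order.TTheory GRing.Theory Num.Theory.
Import numFieldNormedType.Exports.
Local Open Scope classical_set_scope.
Local Open Scope ring_scope.

Definition cosh {R : realType} (t : R) : R := (expR t + expR (- t)) / 2.

(* Modified Bessel function of the second kind K_nu(x), through its integral
   representation on the half-line. It is meaningful for 0 < x only (the
   integral diverges for x <= 0); only positive arguments are used below. *)
Definition besselK {R : realType} (nu x : R) : R :=
  \int[@lebesgue_measure R]_(t in `[0, +oo[)
     (expR (- (x * cosh t)) * cosh (nu * t)).

Definition gh_gamma {R : realType} (alpha beta : R) : R :=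
  Num.sqrt (alpha ^+ 2 - beta ^+ 2).

Definition gh_pdf {R : realType} (lambda alpha beta delta x : R) : R :=
  let gamma := gh_gamma alpha beta in
  let s := Num.sqrt (delta ^+ 2 + x ^+ 2) in
  (gamma / delta) `^ lambda
    / (Num.sqrt (2 * pi) * besselK lambda (delta * gamma))
  * expR (beta * x)
  * (besselK (lambda - 1 / 2) (alpha * s) / (s / alpha) `^ (1 / 2 - lambda)).

(* X ~ GH(lambda, alpha, beta, delta, 0) *)
Definition has_gh_law {R : realType} (d : measure_display)
    (T : measurableType d) (P : probability T R) (X : {RV P >-> R})
    (lambda alpha beta delta : R) : Prop :=
  forall A : set R, measurable A ->
    distribution P X A =
    (\int[@lebesgue_measure R]_(x in A) (gh_pdf lambda alpha beta delta x)%:E)%E.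

Definition median {R : realType} (d : measure_display)
    (T : measurableType d) (P : probability T R) (X : {RV P >-> R}) : R :=
  inf [set x : R | ((1 / 2)%:E <= P [set w | (X w <= x)%R])%E].

Definition u_ {R : realType} (lambda alpha beta delta c : R) : R :=
  let gamma := gh_gamma alpha beta in
  beta / gamma ^+ 2 *
  (lambda - c + Num.sqrt ((lambda - c) ^+ 2 + delta ^+ 2 * gamma ^+ 2)).

(* Med(X) < u_c for all X ~ GH(lambda, alpha, beta, delta, 0), uniformly over
   all admissible parameters such that lambda belongs to L. *)
Definition valid_upper_bound {R : realType} (L : set R) (c : R) : Prop :=
  forall lambda alpha beta delta : R,
    L lambda -> 0 < beta -> beta < alpha -> 0 < delta ->
  forall (d : measure_display) (T : measurableType d) (P : probability T R)
    (X : {RV P >-> R}),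
    has_gh_law X lambda alpha beta delta ->
    median X < u_ lambda alpha beta delta c.

Definition is_largest {R : realType} (A : set R) (c : R) : Prop :=
  A c /\ ubound A c.

(* Main.v *)
Require Import Defs.
From HB Require Import structures.
From mathcomp Require Import all_boot all_order all_algebra.
From mathcomp Require Import all_classical all_reals all_analysis.
From mathcomp Require Import measurable_realfun.
From mathcomp Require Import ring lra.
Set Implicit Arguments.
Unset Strict Implicit.
Unset Printing Implicit Defensive.
Import Order.TTheory GRing.Theory Num.Theory.
Import numFieldNormedType.Exports.
Local Open Scope classical_set_scope.
Local Open Scope ring_scope.

(** A GH variable is a normal mixture: conditionally on W = w > 0 it is normal
    with mean beta w and variance w, and W has the generalized inverse Gaussian
    density, proportional to w^(lambda-1) exp(-(delta^2/w + gamma^2 w)/2).  Put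
    u = beta m and w = m exp y.  The distribution of y has density proportional to
      gig lambda a d y = exp(lambda y - (a e^y + d e^(-y))/2)
    with a = gamma^2 m and d = delta^2/m, and the conditional probability of
    X <= u is 1/2 - g(2 b sinh(y/2)), where b = beta sqrt m and g(z) is the
    Gaussian mass of [0, z].  Hence
      P(X <= beta m) = 1/2 - skew / gigint lambda a d,
    skew being the integral of gig lambda a d times the odd function
    y |-> g(2 b sinh(y/2)) ([integral_gh_pdf_le]); the sign of skew
    places the median with respect to beta m ([gh_median_skew]).  The point u_c
    is beta m for the root m of a - d = 2 (lambda - c) ([u_root]).

    Pairing y with -y, the sign of the integrand of skew for y > 0 is that
    of 2 lambda y - (a - d) sinh y.  For c = 0 this is 2 lambda (y - sinh y), whose
    sign is that of -lambda: the comparison with u_0 follows, with equality for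
    lambda = 0, where the density of y is even.  For c = -1/2 and lambda >= -1/2
    the integrand is still negative for every y > 0.  For lambda < -1/2 it changes
    sign once, from - to +; since z |-> g(z)/z is decreasing, g(2 b sinh(y/2)) may then
    be traded for a multiple of sinh(y/2) ([skew_lt0_crossing]).  What is left is
    an inequality between consecutive Bessel functions, gigint nu < gigint (nu - 1)
    for a - d = 2 nu ([gigint_ratio_lt1]), a consequence of the three-term
    recurrence and of the positivity of the integral of (e^y - 1)^2 gig (nu - 1).

    Conversely, when beta tends to 0 with a and d fixed, skew becomes
    proportional to gigint (lambda + 1/2) - gigint (lambda - 1/2).  If this
    difference is positive, Med(X) > u_c for a small beta ([upper_bound_fails]).
    For c > -1/2 this happens at lambda = -5/2 when a is small
    ([upper_bound_half_optimal]); for c > 0 it happens at lambda = 1 when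
    delta gamma = 1/c, where the ratio of Bessel functions is
    K_(3/2)(x)/K_(1/2)(x) = 1 + 1/x ([upper_bound0_optimal]). *)

(** * Integration over the real line *)

Section integral_tools.
Context {R : realType}.
Local Notation mu := (@lebesgue_measure R).
Local Notation integrableT f := (mu.-integrable [set: R] (EFin \o f)).
Implicit Types (f g : R -> R).

Lemma integrable_measurable f : integrableT f -> measurable_fun setT f.
Proof. by move=> /integrableP[/measurable_EFinP]. Qed.

Lemma integrable_le g f : measurable_fun setT f -> integrableT g ->
  (forall x, `|f x| <= g x) -> integrableT f.
Proof.
move=> mf ig fg; apply: le_integrable ig => //.
  exact/measurable_EFinP.
by move=> x _ /=; rewrite lee_fin (le_trans (fg x))// ler_norm.
Qed.

Lemma integrable_add f g : integrableT f -> integrableT g ->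
  integrableT (fun y => f y + g y).
Proof. by move=> intf intg; exact: (integrableD measurableT intf intg). Qed.

Lemma integrable_sub f g : integrableT f -> integrableT g ->
  integrableT (fun y => f y - g y).
Proof. by move=> intf intg; exact: (integrableB measurableT intf intg). Qed.

Lemma integrable_scale (k : R) f : integrableT f ->
  integrableT (fun y => k * f y).
Proof. by move=> intf; exact: (integrableZl measurableT k intf). Qed.

Lemma measurable_reflect : measurable_fun [set: measurableTypeR R]
  (-%R : R -> measurableTypeR R).
Proof. exact: oppr_measurable. Qed.

Lemma integrable_reflect f : integrableT f -> integrableT (fun y => f (- y)).
Proof.
move=> intf; have mf := integrable_measurable intf.
have mN := measurable_reflect.
apply/integrableP; split.
  by apply/measurable_EFinP; apply: measurableT_comp.
move/integrableP : intf => [_]; apply: le_lt_trans.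
rewrite -(ge0_integral_pushforward mN mu measurableT (f := fun y => `|(f y)%:E|%E))//=.
  rewrite le_eqVlt; apply/orP; left; apply/eqP.
  by apply: eq_measure_integral => //= A mA _; rewrite lebesgue_measureN.
by apply/measurable_EFinP; apply: measurableT_comp.
Qed.

Lemma Rintegral_reflect f : integrableT f ->
  \int[mu]_y f (- y) = \int[mu]_y f y.
Proof.
move=> intf; have mf := integrable_measurable intf.
have intfN := integrable_reflect intf.
rewrite /Rintegral; congr fine.
have := @integral_pushforward _ _ _ _ _ _ measurable_reflect mu setT (EFin \o f)
  _ _ measurableT.
rewrite preimage_setT => <-//.
  by apply: eq_measure_integral => //= A mA _; rewrite lebesgue_measureN.
exact/measurable_EFinP.
Qed.

Lemma ge0_integral_shift f (h : R) : continuous f -> (forall x, 0 <= f x) ->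
  (\int[mu]_y (f (y + h))%:E = \int[mu]_y (f y)%:E)%E.
Proof.
move=> cf f0; have dF : derive1 (fun y : R => y + h) = cst 1.
  by apply/funext => x; rewrite derive1E deriveD// derive_id derive_cst addr0.
rewrite (@increasing_ge0_integration_by_substitutionT _ (fun y => y + h) f)//.
- by apply: eq_integral => x _; rewrite dF/= mulr1.
- by move=> x y; rewrite ltrD2r.
- by rewrite dF => ?; exact: cvg_cst.
- by rewrite dF; exact: is_cvg_cst.
- by rewrite dF; exact: is_cvg_cst.
- exact: cvg_addrr_Ny.
- exact: cvg_addrr.
Qed.

Lemma integral_gt0 (D : set R) f : measurable D -> (0 < mu D)%E ->
  measurable_fun D f -> (forall x, D x -> 0 < f x) ->
  (0 < \int[mu]_(y in D) (f y)%:E)%E.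
Proof.
move=> mD D0 mf fp.
rewrite lt0e integral_ge0 ?andbT; last by move=> x /fp /ltW; rewrite lee_fin.
apply/negP => /eqP e.
have mf' : measurable_fun D (EFin \o f) by exact/measurable_EFinP.
have [N [mN N0 DN]] : ae_eq mu D (EFin \o f) (cst 0%E).
  apply/(ae_eq_integral_abs mu mD mf').
  rewrite -[RHS]e; apply: eq_integral => x /[!inE] /fp /ltW f0.
  by rewrite /= ger0_norm.
suff : (mu D <= mu N)%E by rewrite N0 leNgt D0.
rewrite le_measure ?inE//; apply: subset_trans DN => x Dx /= /(_ Dx).
by move=> [] /eqP; rewrite gt_eqF// fp.
Qed.

Lemma Rintegral_gt0 f : integrableT f -> (forall x, 0 <= f x) ->
  (forall x, 0 < x -> 0 < f x) -> 0 < \int[mu]_y f y.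
Proof.
move=> intf f0 fp; have mf := integrable_measurable intf.
rewrite -lte_fin fineK; last exact: integrable_fin_num.
have : (0 < \int[mu]_(y in `]0%R, 1%R[) (f y)%:E)%E.
  apply: integral_gt0 => //.
  - by rewrite lebesgue_measure_itv/= lte_fin ltr01 oppr0 adde0 lte_fin ltr01.
  - exact: measurable_funTS.
  - by move=> x /=; rewrite in_itv/= => /andP[/fp].
move/lt_le_trans; apply; apply: ge0_subset_integral => //.
- exact/measurable_EFinP.
- by move=> x _; rewrite lee_fin.
Qed.

Lemma Rintegral_derive1_eq0 f : (forall x, derivable f x 1) ->
  continuous (derive1 f) -> integrableT (derive1 f) ->
  f n%:R @[n --> \oo] --> 0 -> f (- n%:R) @[n --> \oo] --> 0 ->
  \int[mu]_y derive1 f y = 0.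
Proof.
move=> df cf' intf' fy fNy.
pose I n : set R := `[- n.+1%:R, n.+1%:R]%classic.
have FTC n : (\int[mu]_(y in I n) (derive1 f y)%:E =
    (f n.+1%:R - f (- n.+1%:R))%:E)%E.
  have cf : continuous f.
    by move=> x; exact/differentiable_continuous/derivable1_diffP/df.
  have n0 : - n.+1%:R < n.+1%:R :> R by rewrite (@lt_trans _ _ 0)// ?oppr_lt0 ltr0n.
  rewrite EFinB; apply: (continuous_FTC2 n0).
  - exact: continuous_subspaceT.
  - split=> [x _||]; first exact: df.
    + by apply: cvg_at_right_filter; exact: cf.
    + by apply: cvg_at_left_filter; exact: cf.
  - by [].
have mf' := integrable_measurable intf'.
have lim1 : (\int[mu]_(y in I n) (derive1 f y)%:E)%E @[n --> \oo] -->
    (\int[mu]_y (derive1 f y)%:E)%E.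
  under eq_fun do rewrite integral_mkcond.
  apply: (@dominated_cvg _ _ _ mu setT measurableT _ _
      (fun y => `|(derive1 f y)%:E|%E)) => //.
  - move=> n; apply/(measurable_restrictT _ _).1; first exact: measurable_itv.
    exact/measurable_EFinP/measurable_funTS.
  - move=> y _; apply: cvg_near_cst.
    near=> n; rewrite patchE mem_set// /I/= in_itv/= -ler_norml.
    have : `|y| <= n%:R by near: n; exact: nbhs_infty_ger.
    by move/le_trans; apply; rewrite ler_nat.
  - exact: integrable_abse.
  - move=> n y _; rewrite patchE; case: ifPn => // _.
    by rewrite abse0 abse_ge0.
have lim2 : (\int[mu]_(y in I n) (derive1 f y)%:E)%E @[n --> \oo] --> (0 - 0)%:E.
  under eq_fun do rewrite FTC.
  apply: cvg_EFin; first exact: nearW.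
  apply: cvgB.
  - by move: fy; rewrite -(cvg_shiftS (fun n : nat => f n%:R)).
  - by move: fNy; rewrite -(cvg_shiftS (fun n : nat => f (- n%:R))).
by rewrite /Rintegral (cvg_unique _ lim1 lim2)//= subr0.
Unshelve. all: by end_near. Qed.

End integral_tools.

(** * The densities gig and their integrals *)

(** The law of the logarithm of a generalized inverse Gaussian variable, up to
    normalization. In the exponent, a + d weighs the even function - cosh y / 2 and a - d
    the odd function - sinh y / 2. *)
Definition gig {R : realType} (s a d y : R) : R :=
  expR (s * y - (a * expR y + d * expR (- y)) / 2).

(** Up to elementary factors, the Bessel function K_s at sqrt(a d). *)
Definition gigint {R : realType} (s a d : R) : R :=
  \int[@lebesgue_measure R]_y gig s a d y.

Section gig_theory.
Context {R : realType}.
Local Notation mu := (@lebesgue_measure R).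
Local Notation integrableT f := (mu.-integrable [set: R] (EFin \o f)).
Implicit Types (s a d y : R).

Lemma gig_gt0 s a d y : 0 < gig s a d y. Proof. exact: expR_gt0. Qed.

Lemma gig_ge0 s a d y : 0 <= gig s a d y. Proof. exact: expR_ge0. Qed.

Lemma gigD r s a d y : gig (s + r) a d y = expR (r * y) * gig s a d y.
Proof. by rewrite /gig -expRD; congr expR; ring. Qed.

Lemma gigN s a d y : gig s a d (- y) = gig (- s) d a y.
Proof. by rewrite /gig opprK; congr expR; ring. Qed.

Lemma is_derive_gig s a d y : is_derive y 1 (gig s a d)
  (s * gig s a d y - (a * gig (s + 1) a d y - d * gig (s - 1) a d y) / 2).
Proof.
rewrite !gigD mul1r mulN1r.
apply: is_derive_eq.
rewrite /gig/= !scaler1 /GRing.scale/=.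
by field.
Qed.

Lemma continuous_gig s a d : continuous (gig s a d).
Proof.
move=> y; apply/differentiable_continuous/derivable1_diffP.
by have [] := is_derive_gig s a d y.
Qed.

(** The exponentials dominate both the linear term and a small quadratic term, so
    the tails are Gaussian at worst. *)
Lemma gig_le s a d : 0 < a -> 0 < d -> exists C e : R,
  0 < e /\ forall y, gig s a d y <= C * expR (- (e * y ^+ 2)).
Proof.
move=> a0 d0; pose h := Num.min a d.
have h0 : 0 < h by rewrite lt_min a0.
exists (expR (2 * s ^+ 2 / h)), (h / 8); split; first by rewrite divr_gt0.
move=> y; rewrite /gig -expRD ler_expR.
have E z : 0 <= z -> z ^+ 2 / 2 <= expR z.
  by move=> z0; have /= := expR_ge1Dxn 1 z0; rewrite (_ : 2`! = 2)//; lra.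
have hE : h * (y ^+ 2 / 2) <= a * expR y + d * expR (- y).
  have [ha hd] : h <= a /\ h <= d by rewrite !ge_min !lexx orbT.
  have [y0|y0] := leP 0 y.
    rewrite -[leLHS]addr0 lerD//; last by rewrite mulr_ge0 ?expR_ge0// ltW.
    by rewrite ler_pM ?(ltW h0)//; [rewrite divr_ge0 ?sqr_ge0|exact: E].
  rewrite -[leLHS]add0r lerD//; first by rewrite mulr_ge0 ?expR_ge0// ltW.
  rewrite ler_pM ?(ltW h0)//; first by rewrite divr_ge0 ?sqr_ge0.
  by rewrite -sqrrN E// oppr_ge0 ltW.
have : 0 <= h / 8 * (y - 4 * s / h) ^+ 2.
  by rewrite mulr_ge0 ?sqr_ge0// divr_ge0// ltW.
have -> : h / 8 * (y - 4 * s / h) ^+ 2 = h / 8 * y ^+ 2 - s * y + 2 * s ^+ 2 / h.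
  by field; rewrite gt_eqF.
lra.
Qed.

Lemma measurable_gig s a d : measurable_fun setT (gig s a d).
Proof. exact: continuous_measurable_fun (@continuous_gig s a d). Qed.

Lemma integrable_gig s a d : 0 < a -> 0 < d -> integrableT (gig s a d).
Proof.
move=> a0 d0; have [C [e [e0 gC]]] := gig_le s a0 d0.
pose sg := Num.sqrt (2 * e)^-1.
have sg0 : 0 < sg by rewrite sqrtr_gt0 invr_gt0 mulr_gt0.
apply: (integrable_le (g := fun y => C / normal_peak sg * normal_pdf 0 sg y)).
- exact: measurable_gig.
- by apply: integrable_scale; exact: integrable_normal_pdf.
move=> y; rewrite ger0_norm ?gig_ge0// (le_trans (gC y))//.
rewrite normal_pdfE ?gt_eqF//= [leRHS]mulrA divfK ?gt_eqF ?normal_peak_gt0 ?gt_eqF//.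
rewrite le_eqVlt; apply/orP; left; apply/eqP; congr (_ * expR _).
rewrite /normal_fun subr0 sqr_sqrtr ?invr_ge0 ?mulr_ge0 ?(ltW e0)//.
by rewrite -mulr_natr; field; rewrite gt_eqF.
Qed.

Lemma gigint_gt0 s a d : 0 < a -> 0 < d -> 0 < gigint s a d.
Proof.
move=> a0 d0; apply: Rintegral_gt0 => [|x|x _].
- exact: integrable_gig.
- exact: gig_ge0.
- exact: gig_gt0.
Qed.

Lemma gigintN s a d : 0 < a -> 0 < d -> gigint (- s) a d = gigint s d a.
Proof.
move=> a0 d0; rewrite /gigint -[RHS]Rintegral_reflect; last exact: integrable_gig.
by apply: eq_Rintegral => y _; rewrite gigN.
Qed.

(** The three-term recurrence of the Bessel functions, by integration of the
    derivative of gig. *)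
Lemma gigint_rec s a d : 0 < a -> 0 < d ->
  2 * s * gigint s a d = a * gigint (s + 1) a d - d * gigint (s - 1) a d.
Proof.
move=> a0 d0; have ig r := integrable_gig r a0 d0.
have dE : derive1 (gig s a d) =
    (fun y => s * gig s a d y - (a * gig (s + 1) a d y - d * gig (s - 1) a d y) / 2).
  by apply/funext => y; rewrite derive1E; have [_ ->] := is_derive_gig s a d y.
have lim (u : R^nat) : (forall n, u n ^+ 2 = n%:R ^+ 2) -> gig s a d (u n) @[n --> \oo] --> 0.
  move=> un; have [C [e [e0 gC]]] := gig_le s a0 d0.
  have e1 : expR (- e) < 1 by rewrite expR_lt1 oppr_lt0.
  apply: (@squeeze_cvgr _ _ _ _ (cst 0) (fun n => C * expR (- e) ^+ n)); last 2 first.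
  - exact: cvg_cst.
  - rewrite -(mulr0 C); apply: cvgM; first exact: cvg_cst.
    by apply: cvg_expr; rewrite ger0_norm ?expR_ge0.
  apply: nearW => n; rewrite gig_ge0/= (le_trans (gC _))// un.
  have C0 : 0 <= C.
    by have := le_trans (gig_ge0 s a d 0) (gC 0); rewrite pmulr_lge0// expR_gt0.
  rewrite ler_wpM2l// -expRM_natl ler_expR mulrN lerN2 mulrC ler_pM2l//.
  by rewrite -natrX ler_nat -mulnn; case: n => // n; rewrite leq_pmulr.
have ic : integrableT (derive1 (gig s a d)).
  rewrite dE; apply: integrable_sub; first exact: integrable_scale.
  under eq_fun do rewrite mulrC.
  by apply: integrable_scale; apply: integrable_sub; exact: integrable_scale.
have cd : continuous (derive1 (gig s a d)).
  rewrite dE => y; apply: cvgB.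
    by apply: cvgM; [exact: cvg_cst|exact: continuous_gig].
  apply: cvgM; last exact: cvg_cst.
  by apply: cvgB; (apply: cvgM; [exact: cvg_cst|exact: continuous_gig]).
have dg y : derivable (gig s a d) y 1 by have [] := is_derive_gig s a d y.
have lp := lim (fun n => n%:R) (fun=> erefl).
have ln := lim (fun n => - n%:R) (fun n => sqrrN _).
have := Rintegral_derive1_eq0 dg cd ic lp ln.
rewrite dE RintegralB//; [|exact: integrable_scale|]; last first.
  under eq_fun do rewrite mulrC.
  by apply: integrable_scale; apply: integrable_sub; exact: integrable_scale.
rewrite RintegralZl// RintegralZr//; last first.
  by apply: integrable_sub; exact: integrable_scale.
rewrite RintegralB//; [|exact: integrable_scale|exact: integrable_scale].
rewrite !RintegralZl// -!/(gigint _ _ _) => H.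
move: (gigint _ a d) (gigint _ a d) (gigint _ a d) H => J Jp Jm; lra.
Qed.

(** This is the bound K_s(x)/K_(s-1)(x) < (s + sqrt(s^2 + x^2))/x, for every real s.
    The recurrence turns the positive integral of (e^y - 1)^2 gig (s - 1) into a
    positive multiple of the difference. *)
Lemma gigint_ratio_lt1 s a d : 0 < a -> 0 < d -> a - d = 2 * s ->
  gigint s a d < gigint (s - 1) a d.
Proof.
move=> a0 d0 ads; have ig r := integrable_gig r a0 d0.
have Q : 0 < gigint (s + 1) a d - 2 * gigint s a d + gigint (s - 1) a d.
  have e y : (expR y - 1) ^+ 2 * gig (s - 1) a d y =
      gig (s + 1) a d y - 2 * gig s a d y + gig (s - 1) a d y.
    rewrite (_ : s + 1 = s - 1 + 2); last by ring.
    rewrite (_ : gig s = gig (s - 1 + 1)); last by congr gig; ring.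
    by rewrite !gigD mul1r (_ : 2 * y = y + y) ?expRD; ring.
  have i1 : integrableT (fun y => gig (s + 1) a d y - 2 * gig s a d y).
    by apply: integrable_sub => //; exact: integrable_scale.
  have -> : gigint (s + 1) a d - 2 * gigint s a d + gigint (s - 1) a d =
      \int[mu]_y ((expR y - 1) ^+ 2 * gig (s - 1) a d y).
    under [RHS]eq_Rintegral do rewrite e.
    by rewrite RintegralD// RintegralB ?RintegralZl//; exact: integrable_scale.
  apply: Rintegral_gt0.
  - by under eq_fun do rewrite e; exact: integrable_add.
  - by move=> y; rewrite mulr_ge0 ?sqr_ge0 ?gig_ge0.
  - move=> y y0; rewrite mulr_gt0 ?gig_gt0// exprn_gt0// subr_gt0.
    by rewrite expR_gt1.
have := mulr_gt0 a0 Q.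
rewrite (_ : a * _ = (a + d) * (gigint (s - 1) a d - gigint s a d)).
  by rewrite pmulr_rgt0 ?subr_gt0// addr_gt0.
have := gigint_rec s a0 d0.
rewrite -ads; clear Q ig ads.
by move: (gigint s a d) (gigint _ a d) (gigint _ a d) => J Jp Jm; lra.
Qed.


End gig_theory.

(** * The hyperbolic sine and the Gaussian mass *)

Definition sinh2 {R : realType} (y : R) : R := expR y - expR (- y).

(** The signed Gaussian mass of the interval from 0 to z, written through the
    distribution function to make oddness and differentiability immediate. *)
Definition gmass {R : realType} (z : R) : R :=
  \int[@lebesgue_measure R]_(x in `]-oo, z]) normal_pdf 0 1 x - 1 / 2.

Section sinh2_theory.
Context {R : realType}.
Implicit Types x y : R.

Lemma sinh20 : sinh2 0 = 0 :> R. Proof. by rewrite /sinh2 oppr0 subrr. Qed.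

Lemma sinh2N y : sinh2 (- y) = - sinh2 y. Proof. by rewrite /sinh2 opprK opprB. Qed.

Lemma is_derive_sinh2 y : is_derive y 1 (@sinh2 R) (expR y + expR (- y)).
Proof. by apply: is_derive_eq; rewrite /GRing.scale/= ?scaler1; ring. Qed.

Lemma continuous_sinh2 : continuous (@sinh2 R).
Proof.
move=> y; apply/differentiable_continuous/derivable1_diffP.
by have [] := is_derive_sinh2 y.
Qed.

Lemma ltr_sinh2 x y : x < y -> sinh2 x < sinh2 y.
Proof. by move=> xy; rewrite /sinh2 ltrB// ltr_expR// ltrN2. Qed.

Lemma sinh2_gt0 y : 0 < y -> 0 < sinh2 y.
Proof. by move=> y0; rewrite -sinh20 ltr_sinh2. Qed.

Lemma ler_cosh2 x y : 0 <= x -> x <= y ->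
  expR x + expR (- x) <= expR y + expR (- y).
Proof.
move=> x0 xy.
have -> : expR y + expR (- y) = expR x + expR (- x) +
    (expR y - expR x) * (1 - expR (- x) * expR (- y)).
  rewrite !expRN; field; by rewrite !gt_eqF ?expR_gt0.
rewrite lerDl mulr_ge0// subr_ge0 ?ler_expR// -expRD -expR0 ler_expR.
lra.
Qed.

Lemma sinh2_MVT x y : x < y -> exists2 c, x < c < y &
  sinh2 y - sinh2 x = (expR c + expR (- c)) * (y - x).
Proof.
move=> xy; have [c] := @MVT R (@sinh2 R) (fun y => expR y + expR (- y)) _ _ xy
  (fun c _ => is_derive_sinh2 c) (continuous_subspaceT continuous_sinh2).
by rewrite in_itv/= => cxy; exists c.
Qed.

Lemma sinh2_gt2x y : 0 < y -> 2 * y < sinh2 y.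
Proof.
move=> y0; have [c /andP[c0 cy]] := sinh2_MVT y0.
rewrite sinh20 !subr0 => ->; rewrite ltr_pM2r//.
rewrite (_ : expR c + expR (- c) = 2 + (expR c - 1) * (1 - expR (- c))); last first.
  by rewrite expRN; field; rewrite gt_eqF ?expR_gt0.
by rewrite ltrDl mulr_gt0// subr_gt0 ?expR_gt1 ?expR_lt1 ?oppr_lt0.
Qed.

(** By convexity of sinh on the half-line, sinh(y)/y is nondecreasing. *)
Lemma sinh2_ratio x y : 0 < x -> x <= y -> y * sinh2 x <= x * sinh2 y.
Proof.
move=> x0; rewrite le_eqVlt => /predU1P[->//|xy].
have [c /andP[c0 cx]] := sinh2_MVT x0; rewrite sinh20 !subr0 => ex.
have [c' /andP[xc' cy']] := sinh2_MVT xy => ey.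
have cc' : expR c + expR (- c) <= expR c' + expR (- c').
  by rewrite ler_cosh2 ?(ltW c0)// ltW// (lt_trans cx).
have -> : sinh2 y = sinh2 x + (expR c' + expR (- c')) * (y - x) by rewrite -ey; ring.
rewrite {}ex; move: cc'; set k := expR c + _; set k' := expR c' + _ => kk'.
have : 0 <= x * ((k' - k) * (y - x)) by rewrite mulr_ge0 ?(ltW x0)// mulr_ge0 ?subr_ge0// ltW.
lra.
Qed.

Lemma sinh2_superlinear (k : R) : exists2 y, 0 < y & k * y < sinh2 y.
Proof.
pose K := `|k|; have K0 : 0 <= K by exact: normr_ge0.
exists (2 * K + 2); first by lra.
have y0 : 0 <= 2 * K + 2 by lra.
have := expR_ge1Dxn 1 y0; rewrite (_ : 2`! = 2)//.
have : expR (- (2 * K + 2)) <= 1 by rewrite expR_le1 oppr_le0.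
rewrite /sinh2.
have : k * (2 * K + 2) <= K * (2 * K + 2) by rewrite ler_wpM2r ?ler_norm.
rewrite (_ : (2 * K + 2) ^+ 2 / 2 = K * (2 * K + 2) + 2 * K + 2); last by field.
lra.
Qed.

End sinh2_theory.

Section gmass_theory.
Context {R : realType}.
Local Notation mu := (@lebesgue_measure R).
Implicit Types x y z : R.
Local Notation phi := (@normal_pdf R 0 1).

Lemma normal_pdf01 x : phi x = phi 0 * expR (- (x ^+ 2 / 2)).
Proof.
rewrite normal_pdfE ?oner_neq0//= /normal_fun !subr0 expr0n/= oppr0 mul0r expR0.
by rewrite mulr1 expr1n mulNr.
Qed.

Lemma normal_pdf01_gt0 x : 0 < phi x.
Proof.
by rewrite normal_pdfE ?oner_neq0//= mulr_gt0 ?expR_gt0// normal_peak_gt0 ?oner_neq0.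
Qed.

Lemma normal_pdf01_le x y : 0 <= x -> x <= y -> phi y <= phi x.
Proof.
move=> x0 xy; rewrite normal_pdf01 [leRHS]normal_pdf01 ler_pM2l ?normal_pdf01_gt0//.
by rewrite ler_expR lerN2 ler_pM2r// ler_sqr// nnegrE (le_trans x0).
Qed.

Lemma normal_pdf01N x : phi (- x) = phi x.
Proof. by rewrite normal_pdf01 sqrrN -normal_pdf01. Qed.

Lemma integrable_phi (A : set R) : measurable A -> mu.-integrable A (EFin \o phi).
Proof.
move=> mA; apply: (@integrableS _ _ _ mu setT) => //.
exact: integrable_normal_pdf.
Qed.

Lemma is_derive_gmass z : is_derive z 1 (@gmass R) (phi z).
Proof.
have z1 : z < z + 1 by rewrite ltrDl.
have [] := @continuous_FTC1 R phi -oo%O z (z + 1) z1 (integrable_phi (measurable_itv _)) _.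
- by rewrite ltNyr.
- by apply: continuous_normal_pdf; exact: oner_neq0.
move=> dF FE; rewrite -FE derive1E -[X in is_derive _ _ _ X]subr0.
by apply: is_deriveB; exact: derivableP.
Qed.

Lemma continuous_gmass : continuous (@gmass R).
Proof.
move=> y; apply/differentiable_continuous/derivable1_diffP.
by have [] := is_derive_gmass y.
Qed.

Lemma gmassN z : gmass (- z) = - gmass z.
Proof.
have e : \int[mu]_(x in `]-oo, - z]) phi x = \int[mu]_(x in `[z, +oo[) phi x.
  rewrite /Rintegral; congr fine; rewrite ge0_integration_by_substitutionNy.
  - by apply: eq_integral => x _ /=; rewrite normal_pdf01N.
  - by apply: continuous_subspaceT; apply: continuous_normal_pdf; exact: oner_neq0.
  - by move=> x _; exact: normal_pdf_ge0.
have t : \int[mu]_(x in `]-oo, z]) phi x + \int[mu]_(x in `[z, +oo[) phi x = 1.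
  rewrite -(@Rintegral_itv_obnd_cbnd _ z +oo%O); last exact: integrable_phi.
  rewrite -Rintegral_setU//.
  - by rewrite -setCitvl setUv /Rintegral integral_normal_pdf.
  - by apply: integrable_phi; exact: measurableU.
  - by rewrite -setCitvl; apply/disj_setPCl.
rewrite /gmass e; move: t; set u := Rintegral _ _ _; set v := Rintegral _ _ _ => t; lra.
Qed.

Lemma gmass0 : gmass 0 = 0 :> R.
Proof. by have := gmassN 0; rewrite oppr0; lra. Qed.

Lemma gmass_MVT x y : x < y -> exists2 c, x < c < y & gmass y - gmass x = phi c * (y - x).
Proof.
move=> xy; have [c] := @MVT R (@gmass R) phi _ _ xy
  (fun c _ => is_derive_gmass c) (continuous_subspaceT continuous_gmass).
by rewrite in_itv/= => cxy; exists c.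
Qed.

Lemma ltr_gmass x y : x < y -> gmass x < gmass y.
Proof.
move=> xy; have [c _] := gmass_MVT xy; rewrite -subr_gt0 => ->.
by rewrite mulr_gt0 ?normal_pdf01_gt0// subr_gt0.
Qed.

Lemma gmass_gt0 z : 0 < z -> 0 < gmass z.
Proof. by move=> z0; rewrite -gmass0 ltr_gmass. Qed.

Lemma gmass_le z : 0 < z -> gmass z <= normal_pdf 0 1 0 * z.
Proof.
move=> z0; have [c /andP[c0 cz]] := gmass_MVT z0; rewrite gmass0 !subr0 => ->.
by rewrite ler_pM2r// normal_pdf01_le// ltW.
Qed.

(** By concavity of the Gaussian distribution function on the half-line, its
    slope from 0 is nonincreasing. *)
Lemma gmass_ratio x y : 0 < x -> x <= y -> x * gmass y <= y * gmass x.
Proof.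
move=> x0; rewrite le_eqVlt => /predU1P[->//|xy].
have [c /andP[c0 cx]] := gmass_MVT x0; rewrite gmass0 !subr0 => ex.
have [c' /andP[xc' cy']] := gmass_MVT xy => ey.
have cc' : phi c' <= phi c.
  by rewrite normal_pdf01_le ?(ltW c0)// ltW// (lt_trans cx).
have -> : gmass y = gmass x + phi c' * (y - x) by rewrite -ey; ring.
rewrite {}ex; move: cc'; set k := phi c; set k' := phi c' => kk'.
have : 0 <= x * ((k - k') * (y - x)) by rewrite mulr_ge0 ?(ltW x0)// mulr_ge0 ?subr_ge0// ltW.
lra.
Qed.

(** Linearization at 0, which governs the regime of small skewness. *)
Lemma gmass_approx z : `|gmass z - phi 0 * z| <= phi 0 * (`|z| ^+ 3 / 2).
Proof.
wlog z0 : z / 0 < z => [H|].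
  have [|z0|->] := ltgtP z 0; last 2 first.
  - exact: H.
  - by rewrite gmass0 mulr0 subr0 normr0 expr0n/= mul0r mulr0.
  move=> z0; have := H (- z); rewrite oppr_gt0 => /(_ z0).
  by rewrite gmassN normrN mulrN -opprB opprK normrN addrC.
have [c /andP[c0 cz]] := gmass_MVT z0; rewrite gmass0 !subr0 => ->.
rewrite normal_pdf01 -mulrA -mulrBr normrM (gtr0_norm (normal_pdf01_gt0 _)).
rewrite ler_pM2l ?normal_pdf01_gt0// -{2}[z]mul1r -mulrBl normrM distrC (gtr0_norm z0).
rewrite (_ : z ^+ 3 / 2 = z ^+ 2 / 2 * z); last by ring.
rewrite ler_pM2r// ger0_norm; last first.
  by rewrite subr_ge0 expR_le1 oppr_le0 divr_ge0 ?sqr_ge0.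
have := expR_ge1Dx (- (c ^+ 2 / 2)).
have : c ^+ 2 <= z ^+ 2 by rewrite ler_sqr ?nnegrE ?ltW// (lt_trans c0).
lra.
Qed.

Lemma gmass_half z : `|gmass z| <= 1 / 2.
Proof.
have H y : - (1 / 2) <= gmass y.
  rewrite /gmass lerBrDr addrC subrr; apply: Rintegral_ge0 => x _.
  exact: normal_pdf_ge0.
by rewrite ler_norml H/= -lerN2 -gmassN H.
Qed.

Lemma normal_probE (m s x : R) : 0 < s ->
  normal_prob m s `]-oo, x] = (1 / 2 + gmass ((x - m) / s))%:E.
Proof.
move=> s0; rewrite /gmass addrC subrK fineK; last first.
  by apply: integrable_fin_num => //; exact: integrable_phi.
pose F (t : R^o) := (t - m) / s.
have dF (t : R) : is_derive t 1 F s^-1.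
  by apply: is_derive_eq; rewrite !scaler0 add0r subr0 /GRing.scale/= mulr1.
have dFE : derive1 F = cst s^-1.
  by apply/funext => t; rewrite derive1E; have [_ ->] := dF t.
rewrite -/(F x) (@increasing_ge0_integration_by_substitutionNy _ F phi x).
- apply: eq_integral => t _; rewrite dFE !fctE/=; congr EFin.
  rewrite !normal_pdfE ?oner_neq0 ?gt_eqF//= /normal_fun /normal_peak subr0.
  rewrite expr1n mul1r [RHS]mulrAC -mulrnAr sqrtrM ?sqr_ge0// sqrtr_sqr gtr0_norm//.
  rewrite invfM (mulrC s^-1); congr (_ * expR _).
  by rewrite /F -mulr_natr; field; rewrite gt_eqF.
- by move=> u v _ _ uv; rewrite /F ltr_pM2r ?invr_gt0// ltrD2r.
- by move=> u _; rewrite dFE; exact: cvg_cst.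
- by rewrite dFE; exact: is_cvg_cst.
- by rewrite dFE; exact: cvg_cst.
- split=> [u _|]; first by have [] := dF u.
  apply: cvg_at_left_filter; apply/differentiable_continuous/derivable1_diffP.
  by have [] := dF x.
- by apply: gt0_cvgMlNy; [rewrite invr_gt0|exact: cvg_addrr_Ny].
- by apply: continuous_subspaceT; apply: continuous_normal_pdf; exact: oner_neq0.
- by move=> u _; exact: normal_pdf_ge0.
Qed.

End gmass_theory.

(** * The sign of the skewness integral *)

(** The defect 1/2 - P(X <= beta m), up to a positive normalization. *)
Definition skew {R : realType} (s a d b : R) : R :=
  \int[@lebesgue_measure R]_y (gig s a d y * gmass (b * sinh2 (y / 2))).

Section skew_theory.
Context {R : realType}.
Local Notation mu := (@lebesgue_measure R).
Local Notation integrableT f := (mu.-integrable [set: R] (EFin \o f)).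
Implicit Types (f : R -> R) (s a d b y : R).

(** Twice the odd part of gig: only this part is seen by odd functions. *)
Definition asym s a d y := gig s a d y - gig s a d (- y).

Lemma asymN s a d y : asym s a d (- y) = - asym s a d y.
Proof. by rewrite /asym opprK opprB. Qed.

Lemma gig_ltN s a d y : (gig s a d y < gig s a d (- y)) =
  (2 * s * y < (a - d) / 2 * sinh2 y).
Proof.
rewrite /gig ltr_expR opprK -subr_gt0 -[RHS]subr_gt0; congr (0 < _).
by rewrite /sinh2; field.
Qed.

Lemma asym_lt0 s a d y : (asym s a d y < 0) = (2 * s * y < (a - d) / 2 * sinh2 y).
Proof. by rewrite /asym subr_lt0 gig_ltN. Qed.

Lemma asym_gt0 s a d y : (0 < asym s a d y) = ((a - d) / 2 * sinh2 y < 2 * s * y).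
Proof.
rewrite -oppr_lt0 -asymN asym_lt0 sinh2N !mulrN.
by rewrite ltrN2.
Qed.

Lemma Rintegral_asym s a d f : 0 < a -> 0 < d -> (forall y, f (- y) = - f y) ->
  integrableT (fun y => gig s a d y * f y) ->
  integrableT (fun y => asym s a d y * f y) /\
  2 * (\int[mu]_y (gig s a d y * f y)) = \int[mu]_y (asym s a d y * f y).
Proof.
move=> a0 d0 fN intf.
have e y : asym s a d y * f y = gig s a d y * f y + gig s a d (- y) * f (- y).
  by rewrite /asym fN; ring.
have intfN := integrable_reflect intf.
split; first by under eq_fun do rewrite e; exact: (integrable_add intf intfN).
under [RHS]eq_Rintegral do rewrite e.
rewrite (RintegralD measurableT intf intfN) (Rintegral_reflect intf).
by rewrite mulr_natl mulr2n.
Qed.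

Lemma gmass_sinh2N b y : gmass (b * sinh2 (- y / 2)) = - gmass (b * sinh2 (y / 2)).
Proof. by rewrite mulNr sinh2N mulrN gmassN. Qed.

Lemma measurable_gmass_sinh2 b : measurable_fun setT (fun y => gmass (b * sinh2 (y / 2))).
Proof.
apply: measurableT_comp.
  exact: continuous_measurable_fun continuous_gmass.
apply: measurable_funM => //; apply: measurableT_comp.
  exact: continuous_measurable_fun continuous_sinh2.
exact: measurable_funM.
Qed.

Lemma integrable_gig_gmass s a d b : 0 < a -> 0 < d ->
  integrableT (fun y => gig s a d y * gmass (b * sinh2 (y / 2))).
Proof.
move=> a0 d0; apply: (integrable_le (g := gig s a d)).
- by apply: measurable_funM; [exact: measurable_gig|exact: measurable_gmass_sinh2].
- exact: integrable_gig.
move=> y; rewrite normrM ger0_norm ?gig_ge0// ler_piMr ?gig_ge0//.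
by rewrite (le_trans (gmass_half _))//; lra.
Qed.

Lemma skewN s a d b : 0 < a -> 0 < d -> skew (- s) d a b = - skew s a d b.
Proof.
move=> a0 d0; rewrite /skew -[in LHS]Rintegral_reflect; last exact: integrable_gig_gmass.
rewrite -[RHS]mulN1r -RintegralZl//; last exact: integrable_gig_gmass.
by apply: eq_Rintegral => y _; rewrite gigN opprK gmass_sinh2N mulrN mulN1r.
Qed.

Lemma skew0 a b : 0 < a -> skew 0 a a b = 0.
Proof. by move=> a0; have := skewN 0 b a0 a0; rewrite oppr0; lra. Qed.

(** The integrand paired with its reflection is negative away from 0. *)
Lemma skew_lt0 s a d b : 0 < a -> 0 < d -> 0 < b ->
  (forall y, 0 < y -> 2 * s * y < (a - d) / 2 * sinh2 y) -> skew s a d b < 0.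
Proof.
move=> a0 d0 b0 H.
have [ic e] := Rintegral_asym a0 d0 (gmass_sinh2N b) (integrable_gig_gmass s b a0 d0).
suff : 0 < \int[mu]_y (- 1 * (asym s a d y * gmass (b * sinh2 (y / 2)))).
  by rewrite RintegralZl// -e -/(skew s a d b); lra.
have P y : 0 < y -> 0 < - 1 * (asym s a d y * gmass (b * sinh2 (y / 2))).
  move=> y0; rewrite mulN1r -mulNr mulr_gt0 ?oppr_gt0 ?asym_lt0 ?H//.
  by rewrite gmass_gt0// mulr_gt0// sinh2_gt0// divr_gt0.
apply: Rintegral_gt0 => //; first exact: integrable_scale.
move=> y; have [y0|y0|->] := ltgtP y 0.
- by have := P (- y); rewrite oppr_gt0 asymN gmass_sinh2N mulrNN => /(_ y0) /ltW.
- exact/ltW/P.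
- by rewrite mul0r sinh20 mulr0 gmass0 !mulr0.
Qed.

(** The first moment that replaces the skewness when the Gaussian mass is
    linearized. *)
Lemma Rintegral_gig_sinh2 s a d : 0 < a -> 0 < d ->
  integrableT (fun y => gig s a d y * sinh2 (y / 2)) /\
  \int[mu]_y (gig s a d y * sinh2 (y / 2)) =
  gigint (s + 1 / 2) a d - gigint (s - 1 / 2) a d.
Proof.
move=> a0 d0.
have e y : gig s a d y * sinh2 (y / 2) = gig (s + 1 / 2) a d y - gig (s - 1 / 2) a d y.
  rewrite !gigD /sinh2 (_ : 1 / 2 * y = y / 2); last by field.
  by rewrite (_ : - (1 / 2) * y = - (y / 2)); [ring|field].
have ig r := integrable_gig r a0 d0; split.
  by under eq_fun do rewrite e; exact: integrable_sub.
by under eq_Rintegral do rewrite e; rewrite RintegralB.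
Qed.

(** For s < -1/2 the odd part D(y) of the density changes sign at most once on the
    half-line, from - to +, because sinh(y)/y is increasing, whereas the quotient q
    of the Gaussian mass by 2 sinh(y/2) is decreasing.  So there is a constant C
    with q <= C where D > 0 and q >= C where D < 0; thus q may be replaced by C in
    the integral, which can only increase it, and the outcome is negative by
    the Bessel ratio bound. *)
Lemma skew_lt0_crossing s a d b : 0 < a -> 0 < d -> 0 < b ->
  s + 1 / 2 < 0 -> a - d = 2 * (s + 1 / 2) -> skew s a d b < 0.
Proof.
move=> a0 d0 b0 s0 ads.
have [ic e] := Rintegral_asym a0 d0 (gmass_sinh2N b) (integrable_gig_gmass s b a0 d0).
have [igd egd] := Rintegral_gig_sinh2 s a0 d0.
have dN y : sinh2 (- y / 2) = - sinh2 (y / 2) by rewrite mulNr sinh2N.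
have [igd' egd'] := Rintegral_asym a0 d0 dN igd.
have neg : \int[mu]_y (asym s a d y * sinh2 (y / 2)) < 0.
  rewrite -egd' egd pmulr_rlt0// subr_lt0.
  rewrite (_ : s - 1 / 2 = s + 1 / 2 - 1); last by field.
  exact: gigint_ratio_lt1.
have pos_iff y : (0 < asym s a d y) = ((s + 1 / 2) * sinh2 y < 2 * s * y).
  by rewrite asym_gt0 ads; congr (_ < _); field.
have neg_iff y : (asym s a d y < 0) = (2 * s * y < (s + 1 / 2) * sinh2 y).
  by rewrite asym_lt0 ads; congr (_ < _); field.
pose q y := gmass (b * sinh2 (y / 2)) / sinh2 (y / 2).
have T0 y : 0 < y -> 0 < sinh2 (y / 2) by move=> y0; rewrite sinh2_gt0// divr_gt0.
have q0 y : 0 < y -> 0 < q y.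
  by move=> y0; rewrite divr_gt0 ?T0// gmass_gt0// mulr_gt0// T0.
have qle x y : 0 < x -> x <= y -> q y <= q x.
  move=> x0 xy; have y0 := lt_le_trans x0 xy.
  rewrite /q ler_pdivrMr ?T0// mulrAC ler_pdivlMr ?T0//.
  have bx : 0 < b * sinh2 (x / 2) by rewrite mulr_gt0// T0.
  have bxy : b * sinh2 (x / 2) <= b * sinh2 (y / 2).
    rewrite ler_pM2l//; move: xy; rewrite le_eqVlt => /predU1P[->//|xy].
    by apply/ltW/ltr_sinh2; rewrite ltr_pM2r// invr_gt0.
  have alg (k l u v : R) : b * u * l <= b * v * k -> l * u <= k * v.
    by rewrite -!mulrA !(ler_pM2l b0) (mulrC u) (mulrC v).
  exact: alg (gmass_ratio bx bxy).
pose S := [set q y | y in [set y | 0 < y /\ 0 < asym s a d y]].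
have [y1 y10 hy1] := sinh2_superlinear (2 * s / (s + 1 / 2)).
have Sy1 : S (q y1).
  exists y1 => //; split => //; rewrite pos_iff.
  have -> : 2 * s * y1 = (s + 1 / 2) * (2 * s / (s + 1 / 2) * y1).
    by rewrite mulrA (mulrC _ (2 * s / _)) divfK// lt_eqF.
  by rewrite ltr_nM2l.
have mono x y : 0 < x -> 0 < y -> asym s a d x < 0 -> 0 < asym s a d y -> x <= y.
  move=> x0 y0 fx fy; rewrite leNgt; apply/negP => yx.
  move: fx fy; rewrite neg_iff pos_iff => fx fy.
  have H := sinh2_ratio y0 (ltW yx).
  have e1 : x * ((s + 1 / 2) * sinh2 y) < x * (2 * s * y) by rewrite ltr_pM2l.
  have e2 : y * (2 * s * x) < y * ((s + 1 / 2) * sinh2 x) by rewrite ltr_pM2l.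
  have : (s + 1 / 2) * (y * sinh2 x) <= (s + 1 / 2) * (x * sinh2 y) by rewrite ler_nM2l.
  clear -e1 e2; lra.
have ubS : has_ubound S.
  exists (normal_pdf 0 1 0 * b) => _ [y [y0 _] <-].
  by rewrite /q ler_pdivrMr ?T0// -mulrA gmass_le// mulr_gt0// T0.
(* The value of q at the crossing point. *)
pose C := sup S.
have C0 : 0 < C by rewrite (lt_le_trans (q0 _ y10))// ub_le_sup.
have P y : 0 < y ->
    asym s a d y * gmass (b * sinh2 (y / 2)) <= C * (asym s a d y * sinh2 (y / 2)).
  move=> y0; rewrite (_ : gmass _ = q y * sinh2 (y / 2)); last first.
    by rewrite /q divfK// gt_eqF// T0.
  rewrite mulrCA mulrA [leRHS]mulrA ler_pM2r ?T0//.
  have [fy|fy|->] := ltgtP (asym s a d y) 0; last by rewrite !mulr0.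
    rewrite ler_nM2r//; apply: ge_sup; first by exists (q y1).
    by move=> _ [z [z0 fz] <-]; rewrite qle// mono.
  by rewrite ler_pM2r// ub_le_sup//; exists y.
have : \int[mu]_y (asym s a d y * gmass (b * sinh2 (y / 2))) <=
    \int[mu]_y (C * (asym s a d y * sinh2 (y / 2))).
  apply: le_Rintegral => //; first exact: integrable_scale.
  move=> y _; have [y0|/P//|->] := ltgtP y 0.
    have := P (- y); rewrite oppr_gt0 asymN gmass_sinh2N mulrNN => /(_ y0).
    by rewrite dN mulrNN.
  by rewrite mul0r sinh20 mulr0 gmass0 !mulr0.
rewrite RintegralZl// -e -/(skew s a d b) => H.
have : C * \int[mu]_y (asym s a d y * sinh2 (y / 2)) < 0 by rewrite pmulr_rlt0.
by move=> /(le_lt_trans H); rewrite pmulr_rlt0.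
Qed.

Lemma skew_lt0_half s a d b : 0 < a -> 0 < d -> 0 < b ->
  a - d = 2 * (s + 1 / 2) -> skew s a d b < 0.
Proof.
move=> a0 d0 b0 ads; have [sn|sp] := ltP (s + 1 / 2) 0.
  exact: skew_lt0_crossing.
apply: skew_lt0 => // y y0; rewrite ads.
rewrite (_ : 2 * _ / 2 = s + 1 / 2); last by field.
have := sinh2_gt2x y0; have := sinh2_gt0 y0.
set D := sinh2 y => D0 D2.
have [s0|s0] := ltP 0 s.
  have : s * (2 * y) < s * D by rewrite ltr_pM2l.
  by lra.
have : 0 <= (s + 1 / 2) * D by rewrite mulr_ge0// ltW.
have := s0; rewrite le_eqVlt => /predU1P[->|s1]; first by lra.
have : s * y < 0 by rewrite nmulr_rlt0.
lra.
Qed.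

(** As b tends to 0 the skewness is asymptotic to b times the first moment, with
    a cubic error. *)
Lemma skew_small_gt0 s a d : 0 < a -> 0 < d ->
  gigint (s - 1 / 2) a d < gigint (s + 1 / 2) a d ->
  exists2 b, 0 < b & 0 < skew s a d b.
Proof.
move=> a0 d0 J; have ig r := integrable_gig r a0 d0.
have [igd egd] := Rintegral_gig_sinh2 s a0 d0.
pose D := \int[mu]_y (gig s a d y * sinh2 (y / 2)).
have D0 : 0 < D by rewrite /D egd subr_gt0.
(* A dominating function for |2 sinh(y/2)|^3, by expansion of (2 cosh(y/2))^3. *)
pose g y := gig (s + 3 / 2) a d y + gig (s - 3 / 2) a d y
   + 3 * (gig (s + 1 / 2) a d y + gig (s - 1 / 2) a d y).
have gE y : g y = gig s a d y * (expR (y / 2) + expR (- (y / 2))) ^+ 3.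
  rewrite /g !gigD.
  rewrite (_ : 1 / 2 * y = y / 2); last by field.
  rewrite (_ : - (1 / 2) * y = - (y / 2)); last by field.
  rewrite (_ : 3 / 2 * y = 3%:R * (y / 2)); last by field.
  rewrite (_ : - (3 / 2) * y = 3%:R * - (y / 2)); last by field.
  rewrite !expRM_natl expRN; field.
  by rewrite gt_eqF ?expR_gt0.
have intg : integrableT g.
  by apply: integrable_add; [|apply: integrable_scale]; exact: integrable_add.
pose G := \int[mu]_y g y.
have G0 : 0 <= G.
  by apply: Rintegral_ge0 => y _; rewrite /g !addr_ge0 ?mulr_ge0 ?addr_ge0 ?gig_ge0.
pose f0 : R := normal_pdf 0 1 0; have f00 : 0 < f0 by exact: normal_pdf01_gt0.
(* With this choice b^2 G < D, so that the cubic error cannot beat the main term. *)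
pose b := Num.sqrt (D / (G + 1)).
have b0 : 0 < b by rewrite sqrtr_gt0 divr_gt0// ltr_wpDl.
have b2 : b ^+ 2 * G <= D.
  rewrite sqr_sqrtr; last by rewrite divr_ge0 ?addr_ge0// ltW.
  rewrite mulrAC ler_pdivrMr ?ltr_wpDl// ler_pM2l//; lra.
exists b => //.
have low y : b * f0 * (gig s a d y * sinh2 (y / 2)) - f0 * (b ^+ 3 / 2) * g y <=
    gig s a d y * gmass (b * sinh2 (y / 2)).
  rewrite gE; set T := sinh2 (y / 2); set W := gig s a d y.
  have W0 : 0 <= W by exact: gig_ge0.
  have Tle : `|T| <= expR (y / 2) + expR (- (y / 2)).
    by rewrite (le_trans (ler_normB _ _))// !ger0_norm ?expR_ge0.
  have T3 : `|T| ^+ 3 <= (expR (y / 2) + expR (- (y / 2))) ^+ 3.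
    by rewrite lerXn2r// ?nnegrE ?addr_ge0 ?expR_ge0.
  have := gmass_approx (b * T); rewrite ler_norml -/f0 => /andP[+ _].
  rewrite normrM (gtr0_norm b0) exprMn => kl.
  have : f0 * (b ^+ 3 * `|T| ^+ 3 / 2) <=
      f0 * (b ^+ 3 * (expR (y / 2) + expR (- (y / 2))) ^+ 3 / 2).
    by rewrite ler_pM2l// ler_pM2r// ler_pM2l ?exprn_gt0.
  set M := (expR _ + _) ^+ 3 => H.
  rewrite (_ : _ - _ = W * (f0 * (b * T) - f0 * (b ^+ 3 * M / 2))); last by field.
  by rewrite ler_wpM2l//; clear -kl H; lra.
have := @le_Rintegral _ _ _ mu setT _ _ measurableT _ (integrable_gig_gmass s b a0 d0)
  (fun y _ => low y).
have i1 : integrableT (fun y => b * f0 * (gig s a d y * sinh2 (y / 2))).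
  exact: integrable_scale.
have i2 : integrableT (fun y => f0 * (b ^+ 3 / 2) * g y) by exact: integrable_scale.
move=> /(_ (integrable_sub i1 i2)); rewrite RintegralB// !RintegralZl//.
rewrite -/D -/G -/(skew s a d b); apply: lt_le_trans.
rewrite (_ : _ - _ = b * f0 * (D - b ^+ 2 * G / 2)); last by field.
by rewrite !mulr_gt0//; clear -b2 D0; lra.
Qed.

End skew_theory.

(** * Bessel functions and the normal mixture *)

Section mixture.
Context {R : realType}.
Local Notation mu := (@lebesgue_measure R).
Local Notation integrableT f := (mu.-integrable [set: R] (EFin \o f)).
Implicit Types (s a d x y nu rho : R).

(** The translation of y by ln rho trades the weights (x, x) for
    (x rho, x / rho). *)
Lemma gigintZ s x rho : 0 < x -> 0 < rho ->
  gigint s x x = rho `^ s * gigint s (x * rho) (x / rho).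
Proof.
move=> x0 r0; have xr0 : 0 < x * rho by rewrite mulr_gt0.
have xr1 : 0 < x / rho by rewrite divr_gt0.
rewrite -RintegralZl//; last exact: integrable_gig.
rewrite /gigint /Rintegral; congr fine.
rewrite -(@ge0_integral_shift _ _ (ln rho)); last 2 first.
- exact: continuous_gig.
- exact: gig_ge0.
apply: eq_integral => y _; congr EFin.
rewrite /powR gt_eqF// /gig -expRD opprD !expRD !expRN lnK ?posrE//.
by rewrite -!expRN -!expRD; congr expR; field; rewrite gt_eqF.
Qed.

Lemma continuous_coshM nu x : continuous (fun t => expR (- (x * cosh t)) * cosh (nu * t)).
Proof.
have cc : continuous (@cosh R).
  move=> t; apply: cvgM; last exact: cvg_cst.
  apply: cvgD; first exact: continuous_expR.
  by apply: continuous_comp; [exact: opp_continuous|exact: continuous_expR].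
move=> t; apply: cvgM.
  apply: (@continuous_comp _ _ _ (fun t => - (x * cosh t)) expR); last exact: continuous_expR.
  by apply: cvgN; apply: cvgM; [exact: cvg_cst|exact: cc].
apply: (@continuous_comp _ _ _ (fun t => nu * t) cosh); last exact: cc.
by apply: cvgM; [exact: cvg_cst|exact: cvg_id].
Qed.

Lemma coshN (t : R) : cosh (- t) = cosh t.
Proof. by rewrite /cosh opprK addrC. Qed.

(** The integrand is the even part of gig nu x x, folded on the half-line. *)
Lemma besselK_gigint nu x : 0 < x -> besselK nu x = gigint nu x x / 2.
Proof.
move=> x0; pose f t : R := expR (- (x * cosh t)) * cosh (nu * t).
have f0 t : 0 <= f t.
  by rewrite mulr_ge0 ?expR_ge0// divr_ge0// addr_ge0 ?expR_ge0.
have fE t : f t = (gig nu x x t + gig (- nu) x x t) * 2^-1.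
  rewrite /f {2}/cosh mulrA; congr (_ * _); rewrite mulrDr -!expRD.
  by congr (expR _ + expR _); rewrite /cosh; field.
have ig r : integrableT (gig r x x) by exact: integrable_gig.
have intf : integrableT f.
  rewrite (_ : f = fun t => 2^-1 * (gig nu x x t + gig (- nu) x x t)); last first.
    by apply/funext => t; rewrite fE mulrC.
  by apply: integrable_scale; exact: integrable_add.
have e1 : \int[mu]_t f t = gigint nu x x.
  under eq_Rintegral do rewrite fE mulrC.
  rewrite RintegralZl//; last exact: integrable_add.
  by rewrite RintegralD// -/(gigint _ _ _) -/(gigint _ _ _) gigintN//; field.
have e2 : \int[mu]_t f t = 2 * besselK nu x.
  rewrite /Rintegral ge0_symfun_integralT//; last 2 first.
  - exact: continuous_coshM.
  - by move=> t; rewrite /f/= mulrN !coshN.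
  rewrite -set_itvcy fineM//.
  by apply: integrable_fin_num => //; apply: (@integrableS _ _ _ mu setT).
by rewrite -e1 e2; field.
Qed.

Lemma besselK_scaled nu x rho : 0 < x -> 0 < rho ->
  besselK nu x = rho `^ nu * gigint nu (x * rho) (x / rho) / 2.
Proof. by move=> x0 r0; rewrite besselK_gigint// (gigintZ nu x0 r0). Qed.

Variables (lambda alpha beta delta m : R).
Hypotheses (beta0 : 0 < beta) (beta_alpha : beta < alpha) (delta0 : 0 < delta).
Hypothesis m0 : 0 < m.

Let gam := gh_gamma alpha beta.
Let a := gam ^+ 2 * m.
Let d := delta ^+ 2 / m.

Lemma gh_gamma2 : gam ^+ 2 = alpha ^+ 2 - beta ^+ 2.
Proof.
rewrite sqr_sqrtr// subr_ge0 ler_sqr ?nnegrE ?(ltW beta_alpha)// ltW//.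
exact: lt_trans beta_alpha.
Qed.

Lemma gh_gamma_gt0 : 0 < gam.
Proof.
rewrite sqrtr_gt0 subr_gt0 ltr_sqr ?nnegrE// ltW//.
exact: lt_trans beta_alpha.
Qed.

(** The joint density of X and the logarithm of W: expanding the square in
    the Gaussian factor releases exp(beta x) and turns gamma^2 into
    gamma^2 + beta^2 = alpha^2, so that a function of the form gig remains. *)
Lemma normal_mixture_kernel x y :
  gig lambda a d y * normal_pdf (beta * (m * expR y)) (Num.sqrt (m * expR y)) x =
  expR (beta * x) / Num.sqrt (2 * pi * m) *
  gig (lambda - 1 / 2) (alpha ^+ 2 * m) ((delta ^+ 2 + x ^+ 2) / m) y.
Proof.
have me0 : 0 < m * expR y by rewrite mulr_gt0 ?expR_gt0.
rewrite normal_pdfE ?gt_eqF ?sqrtr_gt0//= /normal_peak /normal_fun.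
rewrite sqr_sqrtr ?(ltW me0)//.
have -> : m * expR y * pi *+ 2 = 2 * pi * m * expR y by rewrite -mulr_natr; ring.
rewrite sqrtrM; last by rewrite !mulr_ge0 ?pi_ge0// ltW.
rewrite (_ : Num.sqrt (expR y) = expR (y / 2)); last first.
  rewrite -[RHS]ger0_norm ?expR_ge0// -sqrtr_sqr -expRM_natl; congr (Num.sqrt (expR _)).
  by field.
rewrite invfM -expRN; set S := (Num.sqrt _)^-1; set q := expR (- _ / _).
rewrite (_ : _ * q = S * (expR (- (y / 2)) * q)); last by ring.
rewrite mulrCA [RHS](_ : _ = S * (expR (beta * x) *
  gig (lambda - 1 / 2) (alpha ^+ 2 * m) ((delta ^+ 2 + x ^+ 2) / m) y)); last by ring.
congr (_ * _); rewrite /q.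
rewrite /gig -!expRD; congr expR.
rewrite /a /d gh_gamma2 expRN -mulr_natr; field.
by rewrite !gt_eqF ?expR_gt0.
Qed.

Lemma gh_pdfE x : gh_pdf lambda alpha beta delta x =
  expR (beta * x) / Num.sqrt (2 * pi * m) *
  gigint (lambda - 1 / 2) (alpha ^+ 2 * m) ((delta ^+ 2 + x ^+ 2) / m)
  / gigint lambda a d.
Proof.
have g0 := gh_gamma_gt0.
have al0 : 0 < alpha by exact: lt_trans beta_alpha.
rewrite /gh_pdf -/gam; set s := Num.sqrt (delta ^+ 2 + x ^+ 2).
have s2 : s ^+ 2 = delta ^+ 2 + x ^+ 2 by rewrite sqr_sqrtr// addr_ge0// sqr_ge0.
have s0 : 0 < s by rewrite sqrtr_gt0 ltr_wpDr ?sqr_ge0// exprn_gt0.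
have r10 : 0 < m * (gam / delta) by rewrite mulr_gt0// divr_gt0.
have r20 : 0 < m * (alpha / s) by rewrite mulr_gt0// divr_gt0.
rewrite (@besselK_scaled _ _ (m * (gam / delta)))// ?mulr_gt0//.
rewrite (@besselK_scaled _ _ (m * (alpha / s)))// ?mulr_gt0//.
(* The scales are chosen so that both Bessel integrals have the common variable y. *)
have -> : delta * gam * (m * (gam / delta)) = a.
  by rewrite /a; field; rewrite gt_eqF.
have -> : delta * gam / (m * (gam / delta)) = d.
  by rewrite /d; field; rewrite !gt_eqF.
have -> : alpha * s * (m * (alpha / s)) = alpha ^+ 2 * m.
  by field; rewrite gt_eqF.
have -> : alpha * s / (m * (alpha / s)) = (delta ^+ 2 + x ^+ 2) / m.
  by rewrite -s2; field; rewrite !gt_eqF.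
have gd0 : 0 < gam / delta by rewrite divr_gt0.
have as0 : 0 < alpha / s by rewrite divr_gt0.
have a0 : 0 < a by rewrite mulr_gt0// exprn_gt0.
have d0 : 0 < d by rewrite divr_gt0// exprn_gt0.
have := gigint_gt0 lambda a0 d0.
set Z := gigint lambda a d; set J := gigint _ _ _ => Z0.
rewrite (powRM _ (ltW m0) (ltW gd0)) (powRM _ (ltW m0) (ltW as0)).
have -> : (s / alpha) `^ (1 / 2 - lambda) = (alpha / s) `^ (lambda - 1 / 2).
  rewrite -[s / alpha]invf_div -(powR_inv1 (ltW as0)) -powRrM; congr (_ `^ _); ring.
have -> : m `^ (lambda - 1 / 2) = m `^ lambda / Num.sqrt m.
  rewrite powRB ?(gt_eqF m0) ?implybT//; congr (_ / _).
  by rewrite -powR12_sqrt ?(ltW m0)// mul1r.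
rewrite (sqrtrM m); last by rewrite mulr_ge0// pi_ge0.
have p1 : 0 < m `^ lambda by rewrite powR_gt0.
have p2 : 0 < (gam / delta) `^ lambda by rewrite powR_gt0.
have p3 : 0 < (alpha / s) `^ (lambda - 1 / 2) by rewrite powR_gt0.
have p4 : 0 < Num.sqrt (2 * pi) :> R by rewrite sqrtr_gt0 mulr_gt0// pi_gt0.
have p5 : 0 < Num.sqrt m by rewrite sqrtr_gt0.
move: p1 p2 p3 p4 p5 Z0.
move: (m `^ lambda) (_ `^ lambda) (_ `^ _) (Num.sqrt _) (Num.sqrt m) Z J (expR _).
move=> p1 p2 p3 p4 p5 Z J e h1 h2 h3 h4 h5 Z0; field.
by rewrite !gt_eqF.
Qed.

End mixture.

(** * Locating the median *)

Section median_of_density.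
Context {R : realType} d (T : measurableType d) (P : probability T R).
Variable X : {RV P >-> R}.
Implicit Types u x : R.
Local Notation mu := (@lebesgue_measure R).
Local Notation half := ((1 / 2)%:E : \bar R).
Local Notation S := [set x : R | (half <= cdf X x)%E].

Let median_set_lb : exists l, lbound S l.
Proof.
have : \forall x \near -oo, (cdf X x < half)%E.
  apply: (@cvg_cdfNy0 _ _ _ P X [set y | (y < half)%E]).
  by apply: (@nbhs_open_ereal_lt R 0 (fun=> 1 / 2)); lra.
case=> l [_ H]; exists (l - 1) => x /= hx; rewrite leNgt; apply/negP => xl.
by move: hx; rewrite leNgt H//; lra.
Qed.

Let median_set_nonempty : S !=set0.
Proof.
have : \forall x \near +oo, (half < cdf X x)%E.
  apply: (@cvg_cdfy1 _ _ _ P X [set y | (half < y)%E]).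
  by apply: (@nbhs_open_ereal_gt R 1 (fun=> 1 / 2)); lra.
case=> l [_ H]; exists (l + 1) => /=; apply/ltW/H.
by rewrite ltrDl.
Qed.

Lemma median_le u : (half <= cdf X u)%E -> median X <= u.
Proof. by move=> hu; apply: ge_inf. Qed.

Lemma median_ge u : (forall x, x < u -> (cdf X x < half)%E) -> u <= median X.
Proof.
move=> H; apply: lb_le_inf => // x /= hx; rewrite leNgt; apply/negP => /H.
by rewrite ltNge hx.
Qed.

(** By right continuity of the distribution function. *)
Lemma median_gt u : (cdf X u < half)%E -> u < median X.
Proof.
move=> hu; have f : cdf X u \is a fin_num by exact: fin_num_measure.
have : \forall x \near u^'+, (cdf X x < half)%E.
  apply: (@cdf_right_continuous _ _ _ P X u [set y | (y < half)%E]).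
  rewrite -(fineK f); apply: (@nbhs_open_ereal_lt R _ (fun=> 1 / 2)).
  by rewrite -lte_fin fineK.
move=> H; near (u^'+) => v.
have uv : u < v by [].
rewrite (lt_le_trans uv)// median_ge// => x xv.
apply: (@le_lt_trans _ _ (cdf X v)); first by apply: cdf_nondecreasing; exact: ltW.
by near: v; exact: H.
Unshelve. all: by end_near. Qed.

(** Without an atom at u the distribution function is also left continuous
    at u, so it still exceeds 1/2 slightly to the left of u. *)
Lemma median_lt u : distribution P X [set u] = 0%E -> (half < cdf X u)%E ->
  median X < u.
Proof.
move=> Pu hu; rewrite ltNge; apply/negP => uM.
have lt_half x : x < u -> (cdf X x <= half)%E.
  move=> xu; rewrite leNgt; apply/negP => /ltW /median_le /(le_trans uM).
  by rewrite leNgt xu.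
have : (distribution P X `]-oo, u[ <= half)%E.
  pose F n := `]-oo, u - n.+1%:R^-1]%classic.
  have UF : \bigcup_n F n = `]-oo, u[%classic.
    apply/seteqP; split=> x /=.
      move=> [n _]; rewrite /F/= !in_itv/= => /le_lt_trans; apply.
      by rewrite ltrBlDr ltrDl invr_gt0.
    rewrite in_itv/= => xu; exists (Num.truncn (u - x)^-1) => //; rewrite /F/= in_itv/=.
    have ux : 0 < u - x by rewrite subr_gt0.
    rewrite lerBrDr -lerBrDl -[leRHS]invrK lef_pV2 ?posrE ?invr_gt0//.
    by apply/ltW/truncnS_gt.
  have mF n : measurable (F n) by exact: measurable_itv.
  have cvgF : (distribution P X \o F) n @[n --> \oo] --> distribution P X `]-oo, u[.
    rewrite -UF; apply: nondecreasing_cvg_mu => //; first exact: bigcup_measurable.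
    move=> n k nk; apply/subsetPset => x; rewrite /F/= !in_itv/= => /le_trans; apply.
    by rewrite lerD2l lerN2 lef_pV2 ?posrE// ler_nat.
  rewrite -(cvg_lim _ cvgF)//; apply: lime_le; first by apply/cvg_ex; eexists; exact: cvgF.
  by apply: nearW => n; apply: lt_half; rewrite ltrBlDr ltrDl invr_gt0.
move=> H; move: hu; apply/negP; rewrite -leNgt /cdf.
rewrite (_ : `]-oo, u]%classic = `]-oo, u[%classic `|` [set u]); last first.
  by rewrite setUitv1.
apply: le_trans (measureU2 _ _ _) _; [exact: measurable_itv|exact: measurable_set1|].
by rewrite [X in (_ + X)%E]Pu adde0.
Qed.

Section density.
Variable p : R -> R.
Hypotheses (p0 : forall x, 0 < p x) (mp : measurable_fun setT p).
Hypothesis lawX : forall A : set R, measurable A ->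
  distribution P X A = (\int[mu]_(x in A) (p x)%:E)%E.

Lemma median_lt_density u : (half < cdf X u)%E -> median X < u.
Proof. by apply: median_lt; rewrite lawX// integral_set1. Qed.

(** A positive density makes the distribution function strictly increasing. *)
Lemma median_eq_density u : cdf X u = half -> median X = u.
Proof.
move=> hu; apply/eqP; rewrite eq_le median_le ?hu//= median_ge// => x xu.
rewrite -hu /cdf !lawX//.
rewrite (_ : `]-oo, u]%classic = `]-oo, x]%classic `|` `]x, u]%classic); last first.
  by rewrite -itv_bndbnd_setU// bnd_simp ltW.
rewrite ge0_integral_setU//=; last 3 first.
- by apply/measurable_EFinP; exact: measurable_funTS.
- by move=> y _; rewrite lee_fin ltW.
- apply/disj_setPS => y [] /=; rewrite !in_itv/= => /le_lt_trans yx /andP[/yx].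
  by rewrite ltxx.
rewrite lteDl; last first.
- rewrite -lawX//; exact: fin_num_measure.
apply: integral_gt0 => //.
- by rewrite lebesgue_measure_itv/= lte_fin xu -EFinB lte_fin subr_gt0.
- exact: measurable_funTS.
Qed.

End density.

End median_of_density.

(** * The distribution function of the GH law *)

Section gh_law.
Context {R : realType}.
Local Notation mu := (@lebesgue_measure R).
Variables (lambda alpha beta delta m : R).
Hypotheses (beta0 : 0 < beta) (beta_alpha : beta < alpha) (delta0 : 0 < delta).
Hypothesis m0 : 0 < m.

Let gam := gh_gamma alpha beta.
Let a := gam ^+ 2 * m.
Let d := delta ^+ 2 / m.
Let Z := gigint lambda a d.

Let a0 : 0 < a.
Proof. by rewrite mulr_gt0// exprn_gt0// gh_gamma_gt0. Qed.

Let d0 : 0 < d.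
Proof. by rewrite divr_gt0// exprn_gt0. Qed.

Let Z0 : 0 < Z. Proof. exact: gigint_gt0. Qed.

Let kernel (z : R * R) : R := gig lambda a d z.2 *
  normal_pdf (beta * (m * expR z.2)) (Num.sqrt (m * expR z.2)) z.1.

Let kernel_ge0 z : 0 <= kernel z.
Proof. by rewrite mulr_ge0 ?gig_ge0 ?normal_pdf_ge0. Qed.

Let measurable_kernel : measurable_fun setT kernel.
Proof.
rewrite (_ : kernel = fun z => expR (beta * z.1) / Num.sqrt (2 * pi * m) *
  gig (lambda - 1 / 2) (alpha ^+ 2 * m) ((delta ^+ 2 + z.1 ^+ 2) / m) z.2); last first.
  by apply/funext => z; exact: normal_mixture_kernel.
have m1 : measurable_fun [set: R * R] (fun z : R * R => z.1) by exact: measurable_fst.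
have m2 : measurable_fun [set: R * R] (fun z : R * R => z.2) by exact: measurable_snd.
apply: measurable_funM.
  apply: measurable_funM => //; apply: measurableT_comp => //.
  exact: measurable_funM.
rewrite /gig; apply: measurableT_comp => //.
apply: measurable_funB; first exact: measurable_funM.
apply: measurable_funM => //; apply: measurable_funD; apply: measurable_funM => //.
- exact: measurableT_comp.
- apply: measurable_funM => //; apply: measurable_funD => //.
  exact: measurable_funX.
- by apply: measurableT_comp => //; exact: measurableT_comp.
Qed.

Lemma gh_pdf_mixture x : (gh_pdf lambda alpha beta delta x)%:E =
  (Z^-1%:E * \int[mu]_y (kernel (x, y))%:E)%E.
Proof.
have ad : 0 < alpha ^+ 2 * m.
  by rewrite mulr_gt0// exprn_gt0//; exact: lt_trans beta_alpha.
have dd : 0 < (delta ^+ 2 + x ^+ 2) / m.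
  by rewrite divr_gt0// ltr_wpDr ?sqr_ge0// exprn_gt0.
rewrite (gh_pdfE lambda beta0 beta_alpha delta0 m0) -/gam -/a -/d -/Z mulrC EFinM.
congr (_ * _)%E; under eq_integral do rewrite /kernel/= normal_mixture_kernel// EFinM.
rewrite integralZl//; last exact: integrable_gig.
by rewrite EFinM /gigint /Rintegral fineK//; apply: integrable_fin_num => //; exact: integrable_gig.
Qed.

Lemma gh_pdf_gt0 x : 0 < gh_pdf lambda alpha beta delta x.
Proof.
rewrite (gh_pdfE lambda beta0 beta_alpha delta0 m0) divr_gt0//.
apply: mulr_gt0.
  by rewrite divr_gt0 ?expR_gt0// sqrtr_gt0 !mulr_gt0// pi_gt0.
apply: gigint_gt0; first by rewrite mulr_gt0// exprn_gt0//; exact: lt_trans beta_alpha.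
by rewrite divr_gt0// ltr_wpDr ?sqr_ge0// exprn_gt0.
Qed.

Lemma measurable_gh_pdf : measurable_fun setT (gh_pdf lambda alpha beta delta).
Proof.
apply/measurable_EFinP; rewrite (_ : _ \o _ = fun x => (Z^-1%:E * \int[mu]_y (kernel (x, y))%:E)%E).
  apply: measurable_funeM.
  apply: (@measurable_fun_fubini_tonelli_F _ _ _ _ _ mu (fun z => (kernel z)%:E)) => //.
  exact/measurable_EFinP.
by apply/funext => x; rewrite -gh_pdf_mixture.
Qed.

(** By Tonelli: the law is the mixture of normal laws. *)
Lemma integral_gh_pdf (A : set R) : measurable A ->
  (\int[mu]_(x in A) (gh_pdf lambda alpha beta delta x)%:E =
   Z^-1%:E * \int[mu]_y ((gig lambda a d y)%:E *
     normal_prob (beta * (m * expR y)) (Num.sqrt (m * expR y)) A))%E.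
Proof.
move=> mA; have AT : measurable (A `*` [set: R]) by exact: measurableX.
pose f := (fun z => (kernel z)%:E) \_ (A `*` [set: R]).
have mf : measurable_fun setT f.
  apply/(measurable_restrictT _ _).1; first exact: AT.
  apply/measurable_EFinP.
  exact: measurable_funTS.
have f0 z : (0 <= f z)%E by rewrite erestrict_ge0// => u _; rewrite lee_fin.
have mF : measurable_fun setT (fun x => \int[mu]_y f (x, y))%E.
  exact: (@measurable_fun_fubini_tonelli_F _ _ _ _ _ mu f).
under eq_integral do rewrite gh_pdf_mixture.
rewrite integral_mkcond.
transitivity (\int[mu]_x (Z^-1%:E * \int[mu]_y f (x, y)))%E.
  apply: eq_integral => x _; rewrite patchE; case: ifPn => xA.
    congr (_ * _)%E; apply: eq_integral => y _.
    by rewrite /f patchE mem_set//; split => //=; exact/set_mem.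
  rewrite integral0_eq ?mule0// => y _; rewrite /f patchE memNset// => -[/= Ax _].
  by move: xA; rewrite mem_set.
rewrite ge0_integralZl_EFin//; last 2 first.
- by move=> x _; exact: integral_ge0.
- by rewrite invr_ge0 ltW.
congr (_ * _)%E; rewrite (@fubini_tonelli _ _ _ _ _ mu mu f)//.
apply: eq_integral => y _; rewrite /normal_prob -ge0_integralZl_EFin//; last 3 first.
- by move=> x _; rewrite lee_fin normal_pdf_ge0.
- apply/measurable_EFinP/measurable_funTS; exact: measurable_normal_pdf.
- exact: gig_ge0.
rewrite [RHS]integral_mkcond; apply: eq_integral => x _.
rewrite /f !patchE; case: (boolP (x \in A)) => xA.
  by rewrite mem_set//; split => //=; exact/set_mem.
by rewrite memNset// => -[/= Ax _]; move: xA; rewrite mem_set.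
Qed.

Lemma integral_gh_pdf_setT :
  (\int[mu]_x (gh_pdf lambda alpha beta delta x)%:E = 1)%E.
Proof.
rewrite integral_gh_pdf//.
under eq_integral do rewrite [normal_prob _ _ _]integral_normal_pdf mule1.
rewrite -[X in (_ * X)%E]fineK; last first.
  by apply: integrable_fin_num => //; exact: integrable_gig.
by rewrite -EFinM -/(Rintegral _ _ _) -/(gigint _ _ _) mulVf// gt_eqF.
Qed.

Lemma integral_gh_pdf_le :
  (\int[mu]_(x in `]-oo, (beta * m)%R]) (gh_pdf lambda alpha beta delta x)%:E =
   (1 / 2 - skew lambda a d (beta * Num.sqrt m) / Z)%:E)%E.
Proof.
rewrite integral_gh_pdf//.
have ig : mu.-integrable setT (EFin \o gig lambda a d) by exact: integrable_gig.
have igk := integrable_gig_gmass lambda (beta * Num.sqrt m) a0 d0.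
rewrite (_ : 1 / 2 - _ = Z^-1 * (1 / 2 * Z - skew lambda a d (beta * Num.sqrt m))); last first.
  by field; rewrite gt_eqF.
rewrite EFinM; congr (_ * _)%E.
rewrite /Z /gigint -RintegralZl// -RintegralB//; last exact: integrable_scale.
rewrite fineK; last first.
  by apply: integrable_fin_num => //; apply: integrable_sub => //; exact: integrable_scale.
apply: eq_integral => y _.
have me0 : 0 < m * expR y by rewrite mulr_gt0 ?expR_gt0.
rewrite normal_probE ?sqrtr_gt0// -EFinM; congr EFin.
rewrite (_ : (_ - _) / _ = - (beta * Num.sqrt m * sinh2 (y / 2))).
  by rewrite gmassN; ring.
have E : Num.sqrt (expR y) = expR (y / 2).
  rewrite -[RHS]ger0_norm ?expR_ge0// -sqrtr_sqr -expRM_natl; congr (Num.sqrt (expR _)).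
  by field.
have e0 := expR_gt0 (y / 2).
have s0 : 0 < Num.sqrt m by rewrite sqrtr_gt0.
have mE := esym (sqr_sqrtr (ltW m0)).
rewrite sqrtrM ?(ltW m0)// E (_ : expR y = expR (y / 2) ^+ 2); last first.
  by rewrite -expRM_natl; congr expR; field.
rewrite /sinh2 expRN; move: (Num.sqrt m) (expR (y / 2)) s0 e0 mE => r e r0 e0 ->.
by field; rewrite !gt_eqF.
Qed.

End gh_law.

(** * Existence of GH variables, and their median *)

Section gh_median.
Context {R : realType}.
Local Notation mu := (@lebesgue_measure R).
Variables (lambda alpha beta delta : R).
Hypotheses (beta0 : 0 < beta) (beta_alpha : beta < alpha) (delta0 : 0 < delta).

Let gam := gh_gamma alpha beta.

Let gam0 : 0 < gam. Proof. exact: gh_gamma_gt0. Qed.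

Let gh_prob (A : set (measurableTypeR R)) : \bar R :=
  (\int[mu]_(x in A) (gh_pdf lambda alpha beta delta x)%:E)%E.

Let pdf0 x : 0 < gh_pdf lambda alpha beta delta x.
Proof. exact: gh_pdf_gt0 ltr01 _. Qed.

Let measurable_pdf : measurable_fun setT (gh_pdf lambda alpha beta delta).
Proof. exact: measurable_gh_pdf ltr01. Qed.

(** Optimality needs actual random variables: the identity on the line under
    the measure with density gh_pdf. *)
Lemma gh_law_exists : exists (d : measure_display) (T : measurableType d)
  (P : probability T R) (X : {RV P >-> R}), has_gh_law X lambda alpha beta delta.
Proof.
have P0 : gh_prob set0 = 0%E by rewrite /gh_prob integral_set0.
have Pge0 A : (0 <= gh_prob A)%E.
  by apply: integral_ge0 => x _; rewrite lee_fin ltW.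
have intp : mu.-integrable setT (EFin \o gh_pdf lambda alpha beta delta).
  apply/integrableP; split; first exact/measurable_EFinP.
  under eq_integral do rewrite /= gtr0_norm//.
  by rewrite (integral_gh_pdf_setT lambda beta0 beta_alpha delta0 ltr01) ltry.
have Psigma : semi_sigma_additive gh_prob.
  move=> F mF tF mUF; rewrite /gh_prob integral_bigcup//; last first.
    by apply: (@integrableS _ _ _ mu setT).
  apply: is_cvg_ereal_nneg_natsum_cond => n _ _.
  by apply: integral_ge0 => x _; rewrite lee_fin ltW.
have PT : gh_prob setT = 1%E.
  exact: (integral_gh_pdf_setT lambda beta0 beta_alpha delta0 ltr01).
pose M : {measure set (measurableTypeR R) -> \bar R} :=
  HB.pack gh_prob (isMeasure.Build _ _ _ gh_prob P0 Pge0 Psigma).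
pose P : probability (measurableTypeR R) R :=
  HB.pack (Measure.sort M) (Measure_isProbability.Build _ _ _ M PT).
pose X : {mfun (measurableTypeR R) >-> R} :=
  HB.pack (idfun : measurableTypeR R -> R)
    (isMeasurableFun.Build _ _ _ _ (idfun : measurableTypeR R -> R) (@measurable_id _ _ setT)).
exists _, (measurableTypeR R), P, X => A mA.
by rewrite /distribution /pushforward /=.
Qed.

Lemma gh_median_skew (m : R) (d : measure_display) (T : measurableType d)
    (P : probability T R) (X : {RV P >-> R}) : 0 < m ->
    has_gh_law X lambda alpha beta delta ->
  let s := skew lambda (gam ^+ 2 * m) (delta ^+ 2 / m) (beta * Num.sqrt m) in
  [/\ s < 0 -> median X < beta * m,
      s = 0 -> median X = beta * m
    & 0 < s -> beta * m < median X].
Proof.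
move=> m0 lawX s.
have Z0 : 0 < gigint lambda (gam ^+ 2 * m) (delta ^+ 2 / m).
  by apply: gigint_gt0; rewrite ?divr_gt0 ?mulr_gt0 ?exprn_gt0.
have E : cdf X (beta * m) =
    (1 / 2 - s / gigint lambda (gam ^+ 2 * m) (delta ^+ 2 / m))%:E.
  rewrite /cdf lawX; last exact: measurable_itv.
  exact: integral_gh_pdf_le.
split=> hs.
- apply: (median_lt_density lawX); rewrite E lte_fin ltrDl oppr_gt0.
  by rewrite pmulr_llt0// invr_gt0.
- by apply: (median_eq_density pdf0 measurable_pdf lawX); rewrite E hs mul0r subr0.
- by apply: median_gt; rewrite E lte_fin gtrDl oppr_lt0 divr_gt0.
Qed.

End gh_median.

(** * The bounds and their optimality *)

Section bounds.
Context {R : realType}.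

(** The point u_c is beta times the positive root of
    gamma^2 m^2 - 2 (lambda - c) m - delta^2 = 0. *)
Lemma u_root (lambda alpha beta delta c : R) :
  0 < beta -> beta < alpha -> 0 < delta ->
  let gam := gh_gamma alpha beta in
  exists m, [/\ 0 < m, u_ lambda alpha beta delta c = beta * m
    & gam ^+ 2 * m - delta ^+ 2 / m = 2 * (lambda - c)].
Proof.
move=> b0 ba dl0 gam; have gam0 : 0 < gam by exact: gh_gamma_gt0.
set B := lambda - c; pose S := Num.sqrt (B ^+ 2 + delta ^+ 2 * gam ^+ 2).
have dg0 : 0 < delta ^+ 2 * gam ^+ 2 by rewrite mulr_gt0 ?exprn_gt0.
have S2 : S ^+ 2 = B ^+ 2 + delta ^+ 2 * gam ^+ 2.
  by rewrite sqr_sqrtr// addr_ge0 ?sqr_ge0// ltW.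
have BS : 0 < B + S.
  have : `|B| < S by rewrite -sqrtr_sqr ltr_sqrt ?ltrDl// ltr_wpDl ?sqr_ge0.
  by rewrite ltr_norml => /andP[+ _]; lra.
exists ((B + S) / gam ^+ 2); split; first by rewrite divr_gt0// exprn_gt0.
  by rewrite /u_ -/gam -/B -/S; ring.
have -> : delta ^+ 2 / ((B + S) / gam ^+ 2) = S - B.
  have e : delta ^+ 2 * gam ^+ 2 = (B + S) * (S - B) 
    by rewrite (_ : _ * (S - B) = S ^+ 2 - B ^+ 2); [rewrite S2 addrC addKr|ring].
  rewrite invf_div mulrA e mulrAC divff ?mul1r// gt_eqF//.
by field; rewrite gt_eqF.
Qed.

(** The strict inequality is the failure of the bound to first order in beta; a
    small enough beta then gives a counterexample. *)
Lemma upper_bound_fails (L : set R) (lambda a d : R) : L lambda -> 0 < a -> 0 < d ->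
  gigint (lambda - 1 / 2) a d < gigint (lambda + 1 / 2) a d ->
  ~ valid_upper_bound L (lambda - (a - d) / 2).
Proof.
(* gamma is normalized to 1, so that the point u_c is beta a. *)
move=> Ll a0 d0 /(skew_small_gt0 a0 d0)[b b0 sk] ub.
pose beta := b / Num.sqrt a; pose delta := Num.sqrt (a * d).
pose alpha := Num.sqrt (1 + beta ^+ 2).
have sa0 : 0 < Num.sqrt a by rewrite sqrtr_gt0.
have beta0 : 0 < beta by rewrite divr_gt0.
have delta0 : 0 < delta by rewrite sqrtr_gt0 mulr_gt0.
have gam1 : gh_gamma alpha beta = 1.
  rewrite /gh_gamma /alpha sqr_sqrtr; last by rewrite addr_ge0 ?sqr_ge0.
  by rewrite addrK sqrtr1.
have beta_alpha : beta < alpha.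
  rewrite /alpha -[ltLHS]gtr0_norm// -sqrtr_sqr ltr_sqrt ?ltrDr//.
  by rewrite ltr_wpDr ?sqr_ge0.
have [d' [T [P [X lawX]]]] := gh_law_exists lambda beta0 beta_alpha delta0.
have := ub _ _ _ _ Ll beta0 beta_alpha delta0 _ _ _ _ lawX.
have -> : u_ lambda alpha beta delta (lambda - (a - d) / 2) = beta * a.
  rewrite /u_ gam1 expr1n mulr1 divr1 /delta sqr_sqrtr ?mulr_ge0 ?ltW//.
  rewrite (_ : _ ^+ 2 + a * d = ((a + d) / 2) ^+ 2); last by field.
  rewrite sqrtr_sqr ger0_norm; last by rewrite divr_ge0// addr_ge0// ltW.
  by congr (_ * _); field.
have [_ _] := gh_median_skew beta0 beta_alpha delta0 a0 lawX.
rewrite gam1 expr1n mul1r /beta divfK ?gt_eqF//.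
have -> : delta ^+ 2 / a = d.
  by rewrite /delta sqr_sqrtr ?mulr_ge0 ?ltW// mulrAC divff ?mul1r// gt_eqF.
by move=> /(_ sk) /lt_trans h /h; rewrite ltxx.
Qed.

Lemma valid_upper_bound_half (L : set R) : valid_upper_bound L (- (1 / 2)).
Proof.
move=> lambda alpha beta delta _ b0 ba dl0 d T P X lawX.
have [m [m0 -> ad]] := u_root lambda (- (1 / 2)) b0 ba dl0.
have [+ _ _] := gh_median_skew b0 ba dl0 m0 lawX; apply.
apply: skew_lt0_half.
- by rewrite mulr_gt0// exprn_gt0// gh_gamma_gt0.
- by rewrite divr_gt0// exprn_gt0.
- by rewrite mulr_gt0// sqrtr_gt0.
- by rewrite ad opprK.
Qed.

Lemma valid_upper_bound0 : valid_upper_bound [set lambda : R | 0 < lambda] 0.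
Proof.
move=> lambda alpha beta delta /= l0 b0 ba dl0 d T P X lawX.
have [m [m0 -> ad]] := u_root lambda 0 b0 ba dl0.
have [+ _ _] := gh_median_skew b0 ba dl0 m0 lawX; apply.
apply: skew_lt0.
- by rewrite mulr_gt0// exprn_gt0// gh_gamma_gt0.
- by rewrite divr_gt0// exprn_gt0.
- by rewrite mulr_gt0// sqrtr_gt0.
- move=> y y0; rewrite ad subr0 (_ : 2 * lambda / 2 = lambda); last by field.
  by rewrite mulrAC [ltLHS]mulrC ltr_pM2l// sinh2_gt2x.
Qed.

Lemma median_gt_u0 (lambda alpha beta delta : R) : lambda < 0 ->
  0 < beta -> beta < alpha -> 0 < delta ->
  forall (d : measure_display) (T : measurableType d) (P : probability T R)
    (X : {RV P >-> R}), has_gh_law X lambda alpha beta delta ->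
  u_ lambda alpha beta delta 0 < median X.
Proof.
move=> l0 b0 ba dl0 d T P X lawX.
have [m [m0 -> ad]] := u_root lambda 0 b0 ba dl0.
have a0 : 0 < gh_gamma alpha beta ^+ 2 * m by rewrite mulr_gt0// exprn_gt0// gh_gamma_gt0.
have d0 : 0 < delta ^+ 2 / m by rewrite divr_gt0// exprn_gt0.
have [_ _] := gh_median_skew b0 ba dl0 m0 lawX; apply.
rewrite -oppr_lt0 -skewN//; apply: skew_lt0 => //.
  by rewrite mulr_gt0// sqrtr_gt0.
move=> y y0; rewrite -opprB ad subr0 (_ : - (2 * lambda) / 2 = - lambda); last by field.
by rewrite mulrAC [ltLHS]mulrC ltr_pM2l ?oppr_gt0// sinh2_gt2x.
Qed.

Lemma median_eq_u0 (alpha beta delta : R) :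
  0 < beta -> beta < alpha -> 0 < delta ->
  forall (d : measure_display) (T : measurableType d) (P : probability T R)
    (X : {RV P >-> R}), has_gh_law X 0 alpha beta delta ->
  median X = u_ 0 alpha beta delta 0.
Proof.
move=> b0 ba dl0 d T P X lawX.
have [m [m0 -> ad]] := u_root 0 0 b0 ba dl0.
have a0 : 0 < gh_gamma alpha beta ^+ 2 * m by rewrite mulr_gt0// exprn_gt0// gh_gamma_gt0.
have [_ + _] := gh_median_skew b0 ba dl0 m0 lawX; apply.
rewrite (_ : delta ^+ 2 / m = gh_gamma alpha beta ^+ 2 * m) ?skew0//.
by move: ad; rewrite subrr mulr0 => /eqP; rewrite subr_eq0 => /eqP.
Qed.

(** At lambda = -5/2 with a - d = -4 - 2 e, where e = c + 1/2: for a = 0 the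
    recurrence at -2 reads (4 + 2 e) gigint (-3) = 4 gigint (-2), so that
    gigint (-2) > gigint (-3), and the recurrence at -1 controls the perturbation
    for a small a. *)
Lemma upper_bound_half_optimal (c : R) : valid_upper_bound [set: R] c ->
  c <= - (1 / 2).
Proof.
move=> vc; rewrite leNgt; apply/negP => hc.
pose e := c + 1 / 2; have e0 : 0 < e by rewrite /e; lra.
have e2 : 0 < 2 + e by lra.
pose a := e / (2 + e); pose d := a + 4 + 2 * e.
have a0 : 0 < a by rewrite divr_gt0.
have d0 : 0 < d by rewrite /d; lra.
have aE : a * (2 + e) = e by rewrite /a divfK// gt_eqF.
have a1 : a < 1 by rewrite /a ltr_pdivrMr//; lra.
have := @upper_bound_fails setT (- (5 / 2)) a d I a0 d0.
rewrite (_ : - (5 / 2) - (a - d) / 2 = c); last by rewrite /d /e; field.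
apply => //.
rewrite (_ : - (5 / 2) - 1 / 2 = -2 - 1); last by field.
rewrite (_ : - (5 / 2) + 1 / 2 = -2); last by field.
have := gigint_rec (-2) a0 d0; have := gigint_rec (-1) a0 d0.
rewrite (_ : -2 + 1 = -1); last by ring.
rewrite (_ : -1 - 1 = -2); last by ring.
have := gigint_gt0 (-1 + 1) a0 d0; have := gigint_gt0 (-2) a0 d0.
move: (gigint (-1 + 1) a d) (gigint (-1) a d) (gigint (-2) a d) (gigint (-2 - 1) a d).
move=> J0 J1 J2 J3 J20 J00 r1 r2.
have h1 : 2 * J1 <= d * J2.
  have : 0 <= a * J0 by rewrite mulr_ge0 ?ltW.
  by lra.
have h2 : a * d < 2 * (a + 2 * e).
  have -> : a * d = a * (a + 2 + 2 * e) + 2 * a by rewrite /d; ring.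
  have : a * (a + 2 + 2 * e) < a * (2 * (2 + e)) by rewrite ltr_pM2l//; lra.
  have -> : a * (2 * (2 + e)) = 2 * e by rewrite mulrCA aE.
  lra.
rewrite -(ltr_pM2l d0) (_ : d * J3 = 4 * J2 + a * J1); last by lra.
have h3 : a * (2 * J1) <= a * (d * J2) by rewrite ler_pM2l.
have h4 : a * d * J2 < 2 * (a + 2 * e) * J2 by rewrite ltr_pM2r.
have -> : d * J2 = 4 * J2 + (a + 2 * e) * J2 by rewrite /d; ring.
rewrite mulrA in h3; clear -h3 h4; lra.
Qed.

(** At lambda = 1 the recurrence at 1/2 and the symmetry of K in its index give
    a gigint (3/2) = (1 + w) gigint (1/2) with w = delta gamma, and a < 1 + w as soon
    as w = 1/c. *)
Lemma upper_bound0_optimal (c : R) :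
  valid_upper_bound [set lambda : R | 1 <= lambda] c -> c <= 0.
Proof.
move=> vc; rewrite leNgt; apply/negP => c0.
pose B := 1 - c; pose w := c^-1; have w0 : 0 < w by rewrite invr_gt0.
pose S := Num.sqrt (B ^+ 2 + w ^+ 2).
have S2 : S ^+ 2 = B ^+ 2 + w ^+ 2 by rewrite sqr_sqrtr// addr_ge0// sqr_ge0.
have BS : `|B| < S.
  rewrite -sqrtr_sqr ltr_sqrt ?ltrDl ?exprn_gt0//.
  by rewrite ltr_wpDl ?sqr_ge0// exprn_gt0.
move: BS; rewrite ltr_norml => /andP[BS1 BS2].
pose a := S + B; pose d := S - B.
have a0 : 0 < a by rewrite /a; lra.
have d0 : 0 < d by rewrite /d; lra.
have ad : a * d = w ^+ 2 by rewrite /a /d; lra.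
have aw : a < 1 + w.
  have : S < w + c.
    rewrite -(@ltr_pXn2r _ 2)// ?nnegrE; [|by rewrite sqrtr_ge0|by rewrite addr_ge0 ?ltW].
    have wc : w * c = 1 by rewrite /w mulVf// gt_eqF.
    rewrite S2 /B; nra.
  by rewrite /a /B; lra.
have := @upper_bound_fails [set lambda : R | 1 <= lambda] 1 a d (lexx _) a0 d0.
rewrite (_ : 1 - (a - d) / 2 = c); last by rewrite /a /d /B; field.
apply => //.
rewrite (_ : 1 - 1 / 2 = 1 / 2); last by field.
rewrite (_ : 1 + 1 / 2 = 1 / 2 + 1); last by field.
(* This is K_(-1/2) = K_(1/2), read at the scale a / w. *)
have sym : gigint (- (1 / 2)) a d = a / w * gigint (1 / 2) a d.
  have wa : w * (a / w) = a by field; rewrite gt_eqF.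
  have wd : w / (a / w) = d.
    by rewrite invf_div mulrA -expr2 -ad mulrAC divff ?mul1r// gt_eqF.
  have r0 : 0 < a / w by rewrite divr_gt0.
  have h1 := gigintZ (1 / 2) w0 r0; have h2 := gigintZ (- (1 / 2)) w0 r0.
  rewrite wa wd in h1 h2; rewrite gigintN// h1 in h2.
  have p0 : 0 < (a / w) `^ (1 / 2) by rewrite powR_gt0.
  have pp : (a / w) `^ (1 / 2) * (a / w) `^ (1 / 2) = a / w.
    rewrite -powRD ?(gt_eqF r0) ?implybT// (_ : 1 / 2 + 1 / 2 = 1); last by field.
    by rewrite powRr1// ltW.
  rewrite powRN in h2; move: (gigint _ _ _) (gigint _ _ _) h2 => J J' h2.
  move: p0 pp h2; move: (_ `^ _) => p p0 <- h2.
  by rewrite -mulrA h2 mulrA divff ?mul1r// gt_eqF.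
have := gigint_rec (1 / 2) a0 d0.
rewrite (_ : 1 / 2 - 1 = - (1 / 2)); last by field.
rewrite sym; have := gigint_gt0 (1 / 2) a0 d0.
move: (gigint (1 / 2) a d) (gigint (1 / 2 + 1) a d) => J J' J0.
rewrite (mulrA d) (_ : d * (a / w) = w); last first.
  by rewrite mulrA (mulrC d) ad; field; rewrite gt_eqF.
move=> rec; rewrite -(ltr_pM2l a0).
have -> : a * J' = (1 + w) * J by clear -rec; lra.
by rewrite ltr_pM2r.
Qed.

End bounds.

Unset Implicit Arguments.

Theorem theorem2p7 (R : realType) :
  (forall lambda alpha beta delta : R,
     0 < beta -> beta < alpha -> 0 < delta ->
   forall (d : measure_display) (T : measurableType d) (P : probability T R)
     (X : {RV P >-> R}),
     has_gh_law X lambda alpha beta delta ->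
   let gamma := Num.sqrt (alpha ^+ 2 - beta ^+ 2) in
   let u := u_ lambda alpha beta delta in
   [/\ median X < u (- (1 / 2)) /\
       u (- (1 / 2)) =
         beta / gamma ^+ 2 *
         (lambda + 1 / 2
          + Num.sqrt ((lambda + 1 / 2) ^+ 2 + delta ^+ 2 * gamma ^+ 2)),
       u 0 =
         beta / gamma ^+ 2 *
         (lambda + Num.sqrt (lambda ^+ 2 + delta ^+ 2 * gamma ^+ 2)),
       0 < lambda -> median X < u 0,
       lambda = 0 -> median X = u 0
     & lambda < 0 -> u 0 < median X]) /\
  is_largest [set c : R | valid_upper_bound [set: R] c] (- (1 / 2)) /\
  is_largest [set c : R | valid_upper_bound [set lambda : R | 1 <= lambda] c] 0.
Proof.
split; last split.
- move=> lambda alpha beta delta b0 ba dl0 d T P X lawX gamma u; split.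
  + split; first exact: (valid_upper_bound_half (L := setT)) lawX.
    by rewrite /u /u_ opprK.
  + by rewrite /u /u_ subr0.
  + by move=> l0; exact: valid_upper_bound0 lawX.
  + by move=> l0; rewrite /u l0; apply: median_eq_u0 => //; rewrite -l0.
  + by move=> l0; exact: median_gt_u0 lawX.
- by split; [exact: valid_upper_bound_half|exact: upper_bound_half_optimal].
- split; last exact: upper_bound0_optimal.
  move=> lambda alpha beta delta l1; apply: valid_upper_bound0 => /=.
  exact: lt_le_trans l1.
Qed.
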